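(* Let $x$ be a uniformly recurrent morphic sequence over a finite alphabet $A$. Then the subshift $(\Omega(x),S)$ has only finitely many induced dynamical systems on cylinders, up to conjugacy.
   Context: A morphic sequence is $\phi(\sigma^\infty(a))$ with $\sigma:A^*\to A^*$ an endomorphism prolongable on $a$ and $\phi$ a morphism. $\Omega(x)=\{z\in A^{\mathbb Z}: \mathcal L(z)\subset\mathcal L(x)\}$, where $\mathcal L$ denotes the set of finite factors, and $S$ is the shift $(z_n)\mapsto(z_{n+1})$; for uniformly recurrent $x$, $(\Omega(x),S)$ is minimal. A cylinder is a nonempty set $[u.v]=\{z\in\Omega(x): z_{-|u|}\cdots z_{-1}z_0\cdots z_{|v|-1}=uv\}$ for words $u,v$. For a clopen set $U$, the induced system is $(U,S_U)$ where $S_U(z)=S^{r_U(z)}(z)$ and $r_U(z)=\inf\{n>0: S^n(z)\in U\}$. Two dynamical systems $(X,T)$, $(Y,R)$ are conjugate if there is a homeomorphism $h:X\to Y$ with $h\circ T=R\circ h$. *)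

(* Defs.v *)
From HB Require Import structures.
From mathcomp Require Import all_boot all_order all_algebra.
From mathcomp Require Import all_classical topology function_spaces.

Set Implicit Arguments.
Unset Strict Implicit.
Unset Printing Implicit Defensive.

Import Order.TTheory GRing.Theory Num.Theory.

Local Open Scope classical_set_scope.

Section MorphicSequences.
Variables A B : Type.

(* Monoid morphism A^* -> B^*; f [::] = [::] follows by comparing lengths.
   Erasing morphisms are allowed. *)
Definition word_morphism (f : seq A -> seq B) : Prop :=
  forall u v, f (u ++ v) = f u ++ f v.

Definition prolongable (sigma : seq A -> seq A) (a : A) : Prop :=
  (exists u, sigma [:: a] = a :: u) /\
  (fun k => size (iter k sigma [:: a])) @ \oo --> \oo.

(* y = sigma^oo(a): every sigma^k(a) is a prefix of y. *)
Definition is_limit_word (sigma : seq A -> seq A) (a : A) (y : nat -> A) : Prop :=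
  forall k, mkseq y (size (iter k sigma [:: a])) = iter k sigma [:: a].

(* x = phi(y), as an infinite word: the phi-images of the prefixes of y are
   prefixes of x of unbounded length. *)
Definition is_image_word (phi : seq A -> seq B) (y : nat -> A) (x : nat -> B) :
    Prop :=
  (forall n, mkseq x (size (phi (mkseq y n))) = phi (mkseq y n)) /\
  (fun n => size (phi (mkseq y n))) @ \oo --> \oo.

End MorphicSequences.

(* The alphabet B on which sigma acts need not be the alphabet A of x. *)
Definition morphic (A : finType) (x : nat -> A) : Prop :=
  exists (B : finType) (sigma : seq B -> seq B) (a : B) (y : nat -> B)
         (phi : seq B -> seq A),
    [/\ word_morphism sigma, prolongable sigma a, is_limit_word sigma a y,
        word_morphism phi & is_image_word phi y x].

Section Languages.
Variable A : finType.

(* A^Z with the product of the discrete topologies. *)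
Definition biseq : Type := {ptws int -> discrete_topology A}.

HB.instance Definition _ :=
  Topological.copy biseq {ptws int -> discrete_topology A}.

Definition occurs_at (x : nat -> A) (w : seq A) (i : nat) : Prop :=
  mkseq (fun k => x (i + k)%N) (size w) = w.

Definition language (x : nat -> A) : set (seq A) :=
  [set w | exists i, occurs_at x w i].

Definition bi_occurs_at (z : biseq) (w : seq A) (i : int) : Prop :=
  mkseq (fun k => (z (i + k%:Z)%R : A)) (size w) = w.

Definition bi_language (z : biseq) : set (seq A) :=
  [set w | exists i, bi_occurs_at z w i].

Definition uniformly_recurrent (x : nat -> A) : Prop :=
  forall w, language x w ->
    exists g : nat, forall n : nat, exists2 i : nat,
      (n <= i <= n + g)%N & occurs_at x w i.

Definition shift (z : biseq) : biseq := fun n : int => z (n + 1)%R.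

Definition Omega (x : nat -> A) : set biseq :=
  [set z | bi_language z `<=` language x].

(* [u.v] *)
Definition cylinder (x : nat -> A) (u v : seq A) : set biseq :=
  [set z | Omega x z /\ bi_occurs_at z (u ++ v) (- (size u)%:Z)%R].

End Languages.

Section Dynamics.

(* r_U(z) = min {n > 0 : T^n z \in U}, with junk value 0 if z never enters U
   (which does not happen when T is minimal and U is clopen and nonempty). *)
Definition return_time (X : Type) (T : X -> X) (U : set X) (z : X) : nat :=
  match pselect (exists n, (0 < n)%N && `[< U (iter n T z) >]) with
  | left exn => ex_minn exn
  | right _ => 0%N
  end.

Definition induced (X : Type) (T : X -> X) (U : set X) (z : X) : X :=
  iter (return_time T U z) T z.

(* Conjugacy of the systems (U, T) and (V, R), where U and V carry the subspace
   topologies: h restricts to a homeomorphism U -> V, with inverse h', which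
   intertwines T and R. *)
Definition conjugate (X Y : topologicalType) (U : set X) (T : X -> X)
    (V : set Y) (R : Y -> Y) : Prop :=
  exists (h : X -> Y) (h' : Y -> X),
    [/\ (forall z, U z -> V (h z) /\ h' (h z) = z),
        (forall z, V z -> U (h' z) /\ h (h' z) = z),
        {within U, continuous h},
        {within V, continuous h'} &
        forall z, U z -> h (T z) = R (h z)].

End Dynamics.

(* Main.v *)
(** If x is periodic, Omega x is finite and there are only
    finitely many cylinders. Otherwise write x as the image of iterates of a
    non-erasing substitution and pass to a power th for which letter sets, first
    and last growing letters, and images of bounded letters are idempotent. As x
    has no unbounded powers, runs of bounded letters have bounded length, and
    restricting to a growing letter with a minimal set of descendants yields a
    uniformly recurrent language F over a finite alphabet such that, at every
    scale n, x is covered by blocks of length comparable to n arranged according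
    to F. This gives linear recurrence, and aperiodicity bounds return words to a
    word of length n from below by a constant times n. Hence a word w has boundedly
    many return words and occurrences per block, so its derived sequence is read
    off F through one of finitely many local rules. Two cylinders with the same
    rule have the same language of codings by return words, and replacing return
    words by return words with the same index conjugates the induced systems. *)

Require Import Defs.
From mathcomp Require Import all_boot all_order all_algebra.
From mathcomp Require Import all_classical topology function_spaces.
From mathcomp Require Import zify.

Set Implicit Arguments.
Unset Strict Implicit.
Unset Printing Implicit Defensive.

Import GRing.Theory.

Local Open Scope classical_set_scope.

(** * Words and return words *)

Local Arguments prefix : simpl never.

(* Library lemmas produce sequences over [Equality.sort A], which lia does not
   identify with those over [Finite.sort A]. *)
Ltac slia :=
  repeat match goal with
  | A : Finite.type |- _ =>
    progress change (Equality.sort A) with (Finite.sort A) in *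
  end; lia.

(** The dot of a cylinder [u.v] is only an offset p of the origin: the classification sees the word
    w = uv alone. The induced map moves to the next occurrence of w, so it is the shift on the
    sequence of indices of return words; finite windows of a point fix finite parts of this sequence
    and conversely, which gives continuity both ways. The rule is local because a fixed number Q of
    successive blocks at scale |w| contains w: the indices contributed by a block are fixed by it
    and the next Q blocks, whatever follows. A table on words of length at most Q + 1 thus recovers
    the indices along every word of F. There are finitely many tables because F, Q and the bounds on
    the entries do not depend on w; only the blocks do. The obstacle is to get such an F when
    letters grow at different speeds or not at all: the scale is therefore measured by the images of
    one letter, not by a common growth rate. *)

Section Words.
Variable A : finType.
Implicit Types (w r u v V X Y Z : seq A) (ds : seq (seq A)).

Lemma prefix_ex w V : prefix w V -> exists T : seq A, V = w ++ T.
Proof. by case/prefixP=> T ->; exists T. Qed.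

Lemma suffix_ex w V : suffix w V -> exists T : seq A, V = T ++ w.
Proof. by case/suffixP=> T ->; exists T. Qed.

Lemma infix_ex w V : infix w V -> exists X Y : seq A, V = X ++ w ++ Y.
Proof. by case/infixP=> X [Y ->]; exists X, Y. Qed.

Lemma prefix_cat_le w V Y : size w <= size V -> prefix w (V ++ Y) = prefix w V.
Proof.
by move=> le_wV; rewrite !prefixE takel_cat.
Qed.

Lemma infix_index_cat w V Y :
  infix w V -> infix_index w (V ++ Y) = infix_index w V.
Proof.
elim: V => [|c V IH] inf.
  by move: inf; rewrite infixs0 => /eqP ->; rewrite !infix_index0s.
have le_w : size w <= size (c :: V) by apply: size_infix.
rewrite /= -cat_cons prefix_cat_le //.
move: inf => /=; case: ifP => //= _ inf; by rewrite IH.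
Qed.

Lemma infix_index_prefix w V : infix w V -> prefix w (drop (infix_index w V) V).
Proof.
elim: V => [|c V IH] inf.
  by move: inf; rewrite infixs0 => /eqP ->.
move: inf => /=; case: ifP => [p _|_ /= inf]; first by rewrite drop0.
exact: IH.
Qed.

Lemma infix_index_min w V j : prefix w (drop j V) -> infix_index w V <= j.
Proof.
elim: V j => [|c V IH] j /=; first by rewrite prefixs0 => /eqP ->.
case: j => [|j] /=; first by move->.
by move=> p; case: ifP => // _; apply: IH.
Qed.

(** The words read from each occurrence of [w] in [V] to the next. What precedes the first
    occurrence or follows the start of the last one is dropped, so a single occurrence gives the
    empty list. *)
Fixpoint rets w V : seq (seq A) :=
  if V is c :: V' then
    (if prefix w V && infix w V' then [:: take (infix_index w V').+1 V] else [::])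
      ++ rets w V'
  else [::].

Lemma rets_cons w c V : rets w (c :: V) =
  (if prefix w (c :: V) && infix w V
   then [:: take (infix_index w V).+1 (c :: V)] else [::]) ++ rets w V.
Proof. by []. Qed.

(** The test is on [r ++ w] because occurrences may overlap and [r] may be shorter than [w].
    [behead] skips the occurrence at 0, hence the predecessor of [size r]. *)
Definition isret w r : bool :=
  [&& r != [::], prefix w (r ++ w)
    & infix_index w (behead (r ++ w)) == (size r).-1].

Lemma rets_nil w V : ~~ infix w V -> rets w V = [::].
Proof.
elim: V => //= c V IH; rewrite negb_or => /andP[/negbTE -> /IH ->].
by [].
Qed.

Lemma rets_drop_index w V :
  infix w V -> rets w (drop (infix_index w V) V) = rets w V.
Proof.
elim: V => // c V IH inf; rewrite /= in inf *.
case: ifP inf => [p _|_ /= inf]; first by rewrite drop0 /= p.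
by rewrite IH.
Qed.

(* Only the occurrences of w that begin before V contribute to C, and the next
   occurrence after each of them is visible in X ++ V. *)
Lemma rets_catl w X V : infix w V ->
  exists C, forall Y, rets w (X ++ V ++ Y) = C ++ rets w (V ++ Y).
Proof.
move=> inf; elim: X => [|c X [C IH]]; first by exists [::].
have infX : infix w (X ++ V) by apply: infix_catl.
have le_w : size w <= size (c :: X ++ V).
  by apply: leq_trans (size_infix infX) _.
exists ((if prefix w (c :: X ++ V)
  then [:: take (infix_index w (X ++ V)).+1 (c :: X ++ V)] else [::]) ++ C).
move=> Y; have E : c :: (X ++ V) ++ Y = (c :: X ++ V) ++ Y by [].
have ipl : infix_index w (X ++ V) <= size (X ++ V) by rewrite infixTindex.
rewrite -catA -IH (catA X) cat_cons (catA X) rets_cons E.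
rewrite prefix_cat_le // (infix_catr _ infX) andbT infix_index_cat //.
by rewrite takel_cat.
Qed.

Lemma isret_prefix w r T : isret w r -> prefix w T -> prefix w (r ++ T).
Proof.
case/and3P=> _ p _ /prefix_ex[T' ->]; rewrite catA prefix_cat_le //.
by rewrite size_cat leq_addl.
Qed.

Lemma flatten_prefix w ds T :
  all (isret w) ds -> prefix w T -> prefix w (flatten ds ++ T).
Proof.
elim: ds => //= r ds IH /andP[ir ids] pT; rewrite -catA.
by apply: isret_prefix => //; apply: IH.
Qed.

Lemma rets_isret_cat w r T : isret w r -> prefix w T ->
  rets w (r ++ T) = r :: rets w T.
Proof.
move=> ir /[dup] pT /prefix_ex[T' eT]; have := isret_prefix ir pT.
case: r ir => //= c r /and3P[_ _ /eqP /= id] ->.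
have inf : infix w (r ++ w) by apply: suffix_infix.
have idT : infix_index w (r ++ T) = size r.
  by rewrite eT catA infix_index_cat.
have infT : infix w (r ++ T) by rewrite eT catA; apply: infix_catr.
rewrite infT idT take_size_cat //=; congr (_ :: _).
by rewrite -(rets_drop_index infT) idT drop_size_cat.
Qed.

Lemma rets_flatten w ds T : all (isret w) ds -> prefix w T ->
  rets w (flatten ds ++ T) = ds ++ rets w T.
Proof.
elim: ds => //= r ds IH /andP[ir ids] pT.
by rewrite -catA rets_isret_cat ?IH // flatten_prefix.
Qed.

Lemma isret_take w c V : prefix w (c :: V) -> infix w V ->
  isret w (take (infix_index w V).+1 (c :: V)).
Proof.
move=> p inf.
have /prefix_ex[T eT] := infix_index_prefix inf.
set j := infix_index w V in eT *.
have le_j : j <= size V by rewrite infixTindex.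
have eV : V = take j V ++ w ++ T by rewrite -eT cat_take_drop.
apply/and3P; split=> //=.
  have -> : c :: take j V ++ w = take (j.+1 + size w) (c :: V).
    rewrite /= {2}eV takeD; congr (_ :: _ ++ _).
      by rewrite -eV.
    by rewrite -eV eT take_size_cat.
  by move: p; rewrite !prefixE take_takel // leq_addl.
rewrite size_takel //; apply/eqP.
rewrite -(@infix_index_cat w (take j V ++ w) T) ?suffix_infix //.
by rewrite -catA -eV.
Qed.

Lemma rets_all w V : all (isret w) (rets w V).
Proof.
elim: V => //= c V IH; rewrite all_cat IH andbT.
by case: ifP => //= /andP[p inf]; rewrite andbT isret_take.
Qed.

Lemma rets_decomp w V : infix w V -> exists Y,
  [/\ V = take (infix_index w V) V ++ flatten (rets w V) ++ Y,
      prefix w Y & (w != [::] -> ~~ infix w (behead Y))].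
Proof.
elim: V => [|c V IH] inf.
  by move: inf; rewrite infixs0 => /eqP ->; exists [::].
have [pw|npw] := boolP (prefix w (c :: V)).
  have i0 : infix_index w (c :: V) = 0 by rewrite prefix_index.
  rewrite i0 take0.
  have [infV|ninfV] := boolP (infix w V).
    have [Y [eV pY nY]] := IH infV; exists Y; split=> //.
    by rewrite /= pw infV /= -catA -eV.
  by exists (c :: V); split=> //=; rewrite pw /= (negbTE ninfV) rets_nil.
have infV : infix w V by move: inf; rewrite /= (negbTE npw).
have [Y [eV pY nY]] := IH infV; exists Y; split=> //.
by move: npw => /negbTE /= ->; rewrite /= -eV.
Qed.

Lemma isret_next w r j : isret w r -> prefix w (drop j (r ++ w)) ->
  0 < j -> size r <= j.
Proof.
case: r => //= c r /and3P[_ _ /eqP /= id]; case: j => //= j p _.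
by rewrite ltnS -id; apply: infix_index_min.
Qed.

Lemma rets_self w : rets w w = [::].
Proof.
case: w => // c w; rewrite rets_cons.
have ninf : ~~ infix (c :: w) w.
  by apply/negP => /size_infix /=; rewrite ltnn.
by rewrite (negbTE ninf) andbF rets_nil.
Qed.

Lemma infix_flatten_rets w V ds : infix w V -> infix ds (rets w V) ->
  infix (flatten ds ++ w) V.
Proof.
move=> infV /infixP[d1 [d2 ed]]; have [Y [-> pY _]] := rets_decomp infV.
have := rets_all w V; rewrite ed !all_cat => /and3P[_ _ i2].
have /prefix_ex[T eT] := flatten_prefix i2 pY.
rewrite !flatten_cat -!catA eT; apply: infix_catl; apply: infix_catl.
by rewrite catA; apply: infix_catr; apply: infix_refl.
Qed.

Lemma infix_rets_flatten w V ds : all (isret w) ds ->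
  infix (flatten ds ++ w) V -> infix ds (rets w V).
Proof.
move=> ids /infix_ex[X [Y ->]]; have infw : infix w (flatten ds ++ w).
  exact: suffix_infix.
have [C eC] := rets_catl X infw.
by rewrite eC -catA rets_flatten ?prefix_prefix // infix_infix.
Qed.

(** Return words form a code: [rets] recovers the factors of a concatenation that is followed by
    [w]. *)
Lemma flatten_prefix_inj w V ds ds' : all (isret w) ds -> all (isret w) ds' ->
  size ds = size ds' -> prefix (flatten ds ++ w) V ->
  prefix (flatten ds' ++ w) V -> ds = ds'.
Proof.
move=> i i' sz /prefix_ex[Y eV] /prefix_ex[Y' eV'].
have e : rets w V = ds ++ rets w (w ++ Y).
  by rewrite eV -catA rets_flatten ?prefix_prefix.
have e' : rets w V = ds' ++ rets w (w ++ Y').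
  by rewrite eV' -catA rets_flatten ?prefix_prefix.
move: e'; rewrite e => /(congr1 (take (size ds))).
by rewrite take_size_cat // sz take_size_cat.
Qed.

Lemma flatten_suffix_inj w V ds ds' : all (isret w) ds -> all (isret w) ds' ->
  size ds = size ds' -> suffix (flatten ds ++ w) V ->
  suffix (flatten ds' ++ w) V -> ds = ds'.
Proof.
have key d X : all (isret w) d -> exists C, rets w (X ++ flatten d ++ w) = C ++ d.
  move=> i; have [|C eC] := @rets_catl w X (flatten d ++ w).
    exact: suffix_infix.
  exists C; have := eC [::]; rewrite cats0 => ->.
  by rewrite rets_flatten ?prefix_refl // rets_self cats0.
move=> i i' sz /suffix_ex[X eV] /suffix_ex[X' eV'].
have [C e] := key _ X i; have [C' e'] := key _ X' i'.
move: e'; rewrite -eV' eV e => eC.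
have sC : size C = size C'.
  by have := congr1 size eC; rewrite !size_cat sz => /addIn.
move/(congr1 (drop (size C))): eC.
by rewrite drop_size_cat // sC drop_size_cat.
Qed.

(* r is read between the last two occurrences of w in V ++ w. *)
Lemma isret_last w V : w != [::] -> infix w V ->
  exists2 r, isret w r & suffix (r ++ w) (V ++ w).
Proof.
move=> w0 infV.
have [Y [eV pY nY]] := rets_decomp (infix_catr w infV).
have sY : size Y <= size w.
  rewrite leqNgt; apply/negP => lt; move: (nY w0).
  have : suffix (behead Y) (V ++ w).
    rewrite eV; do 2 apply: suffix_catr.
    by case: (Y) => [|y Y'] /=; rewrite ?suffix_cons.
  case/suffix_ex=> X eX; have sb : size w <= size (behead Y).
    by rewrite size_behead; slia.
  have -> // : infix w (behead Y).
  apply/suffixW; rewrite suffixE; apply/eqP.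
  have := congr1 (drop (size V)) eX; rewrite [LHS]drop_size_cat // => ew.
  have sz := congr1 size eX; rewrite !size_cat in sz; rewrite [RHS]ew.
  by rewrite drop_cat; case: ltnP => h; [slia|congr drop; slia].
have eY : Y = w.
  case/prefix_ex: pY sY => T ->; rewrite size_cat -{2}[size w]addn0 leq_add2l.
  by rewrite leqn0 => /nilP ->; rewrite cats0.
move: eV (rets_all w (V ++ w)); rewrite eY.
case: (lastP (rets w (V ++ w))) => [|ds r].
  rewrite /= infix_index_cat // => eV.
  have := congr1 size eV; rewrite !size_cat size_takel; last first.
    by rewrite size_cat; apply: leq_trans (leq_addr _ _); rewrite infixTindex.
  move=> sz; have /size_prefix := infix_index_prefix infV.
  by rewrite size_drop; case: (w) w0 sz => //= c w' _; slia.
rewrite all_rcons => eV /andP[ir _]; exists r => //.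
by rewrite eV -cats1 flatten_cat /= cats0 !catA -catA suffix_suffix.
Qed.

Lemma size_flatten_ge ds m k : (forall r, r \in ds -> k <= m * size r) ->
  k * size ds <= m * size (flatten ds).
Proof.
elim: ds => [|r ds IH] h /=; first by rewrite muln0.
rewrite size_cat mulnDr mulnS leq_add ?h ?mem_head // IH // => r' r'ds.
by apply: h; rewrite inE r'ds orbT.
Qed.

Lemma size_flatten_rets w V : size (flatten (rets w V)) <= size V.
Proof.
have [infV|ninf] := boolP (infix w V); last by rewrite rets_nil.
have /size_infix := infix_flatten_rets infV (infix_refl _).
by rewrite size_cat; slia.
Qed.

Lemma infix_straddle V X Y Z : infix V (X ++ Y ++ Z) -> ~~ infix V (X ++ Y) ->
  ~~ infix V (Y ++ Z) ->
  exists X' Z' : seq A, [/\ V = X' ++ Y ++ Z', suffix X' X & prefix Z' Z].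
Proof.
case/infix_ex=> p [s e] n1 n2.
have sz := congr1 size e; rewrite !size_cat in sz.
have ltp : size p < size X.
  rewrite ltnNge; apply: contra n2 => le.
  have := congr1 (drop (size X)) e; rewrite drop_size_cat // => ->.
  rewrite drop_cat; case: ltnP => h; first by rewrite infix_catl ?prefix_infix.
  have -> : size X - size p = 0 by slia.
  by rewrite drop0 prefix_infix.
have eV : V ++ s = drop (size p) X ++ Y ++ Z.
  by have := congr1 (drop (size p)) e; rewrite drop_cat ltp drop_size_cat.
have lts : size s < size Z.
  rewrite ltnNge; apply: contra n1 => le.
  have := congr1 (take (size V)) eV; rewrite take_size_cat // => ->.
  rewrite catA takel_cat; last by rewrite size_cat size_drop; slia.
  apply: infix_trans (infix_take _ _) _; apply: suffixW.
  by rewrite -{2}(cat_take_drop (size p) X) -catA suffix_suffix.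
exists (drop (size p) X), (take (size Z - size s) Z).
split; [|exact: suffix_drop|exact: prefix_take].
have := congr1 (take (size V)) eV; rewrite take_size_cat // => ->.
rewrite take_cat ltnNge size_drop [_ <= _](_ : _ = true) /=; last by slia.
rewrite take_cat ltnNge [_ <= _](_ : _ = true) /=; last by slia.
by congr (_ ++ _ ++ take _ _); slia.
Qed.

End Words.

(** * Substitutions and the covering of a factor by images of letters *)

Section Substitution.
Variables A B : finType.
Implicit Types (psi : B -> seq A) (u : seq B).

Definition sub (psi : B -> seq A) (u : seq B) : seq A := flatten (map psi u).

Lemma sub_cat psi u v : sub psi (u ++ v) = sub psi u ++ sub psi v.
Proof. by rewrite /sub map_cat flatten_cat. Qed.

Lemma sub1 psi b : sub psi [:: b] = psi b.
Proof. by rewrite /sub /= cats0. Qed.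

Lemma sub_cons psi b u : sub psi (b :: u) = psi b ++ sub psi u.
Proof. by []. Qed.

Lemma sub_rcons psi b u : sub psi (rcons u b) = sub psi u ++ psi b.
Proof. by rewrite -cats1 sub_cat sub1. Qed.

Lemma infix_sub psi u v : infix u v -> infix (sub psi u) (sub psi v).
Proof. by case/infix_ex=> p [s ->]; rewrite !sub_cat infix_infix. Qed.

Lemma mem_infix_sub psi b u : b \in u -> infix (psi b) (sub psi u).
Proof. by rewrite -infix1s -(sub1 psi) => /infix_sub. Qed.

Lemma size_sub_le psi u m : (forall b, b \in u -> size (psi b) <= m) ->
  size (sub psi u) <= size u * m.
Proof.
elim: u => //= b u IH h; rewrite sub_cons size_cat mulSn leq_add ?h ?mem_head //.
by apply: IH => c cu; apply: h; rewrite inE cu orbT.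
Qed.

Lemma size_sub_ge psi u : (forall b, psi b != [::]) -> size u <= size (sub psi u).
Proof.
move=> h; elim: u => //= b u IH; rewrite sub_cons size_cat.
by have := h b; rewrite -size_eq0; slia.
Qed.

(** Letters are trimmed from both ends of [u] while [V] still fits. When neither end can go, [V]
    meets both extreme blocks and contains all inner ones, which ties its length to the number of
    blocks. *)
Lemma sub_cover psi (V : seq A) u : infix V (sub psi u) ->
  exists u' : seq B, [/\ infix u' u, infix V (sub psi u') &
    (size u' <= 1)%N \/ exists b (v : seq B) b' (X Z : seq A),
      [/\ u' = b :: rcons v b', V = X ++ sub psi v ++ Z, suffix X (psi b)
        & prefix Z (psi b')]].
Proof.
have [n] := ubnP (size u); elim: n u => // n IH u ltn inf.
case: u ltn inf => [|b u] ltn inf; first by exists [::]; split => //; left.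
case: (lastP u) ltn inf => [|v b'] ltn inf.
  by exists [:: b]; split => //; [exact: infix_refl|left].
rewrite /= size_rcons in ltn.
have [i1|n1] := boolP (infix V (sub psi (b :: v))).
  have [|u' [iu' iV c]] := IH _ _ i1; first by rewrite /=; slia.
  exists u'; split => //; apply: infix_trans iu' _.
  by rewrite -rcons_cons infix_rcons.
have [i2|n2] := boolP (infix V (sub psi (rcons v b'))).
  have [|u' [iu' iV c]] := IH _ _ i2; first by rewrite size_rcons; slia.
  exists u'; split => //; apply: infix_trans iu' _; exact: infix_cons.
exists (b :: rcons v b'); split=> //; first exact: infix_refl.
right; rewrite sub_cons sub_rcons in inf n1 n2 *.
have [X [Z [-> sX pZ]]] := infix_straddle inf n1 n2.
by exists b, v, b', X, Z.
Qed.

End Substitution.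

(** * Convergence and continuity in the product topology through finite windows *)

Section Topology.
Variable A : finType.

Lemma biseq_cvg (F : set_system (biseq A)) (z : biseq A) : Filter F ->
  (forall i : int, F [set y : biseq A | y i = z i]) -> F --> z.
Proof.
move=> FF h; apply/cvg_sup => i; apply/cvg_image => //.
  by rewrite eqEsubset; split=> v // _; exists (cst v).
move=> W /nbhs_singleton Wz.
exists ((fun y : biseq A => y i) @^-1` W).
  by apply: filterS (h i) => y /= ->.
by rewrite eqEsubset; split => [j [? + <-//]|j Wj]; exists (fun _ => j).
Qed.

Lemma nbhs_coord (z : biseq A) (i : int) : nbhs z [set y : biseq A | y i = z i].
Proof.
have /= := @proj_continuous int (fun _ => discrete_topology A) i z [set z i].
by apply; apply: discrete_set1.
Qed.

Lemma nbhs_window (z : biseq A) (n : nat) :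
  nbhs z [set y : biseq A | forall j : int, (`|j| <= n)%N -> y j = z j].
Proof.
elim: n => [|n IH].
  apply: filterS (nbhs_coord z 0%R) => y /= yz j; rewrite leqn0 absz_eq0.
  by move/eqP->.
apply: filterS (filterI IH (filterI (nbhs_coord z n.+1%:Z)
  (nbhs_coord z (- n.+1%:Z)%R))) => y /= [y1 [y2 y3]] j jn.
have [|] := leqP `|j|%N n; first exact: y1.
move=> jn'; have [->|->] // : (j = n.+1%:Z \/ j = - n.+1%:Z)%R by slia.
Qed.

Lemma biseq_continuous (U : set (biseq A)) (h : biseq A -> biseq A) :
  (forall z, U z -> forall i : int, exists n : nat, forall y, U y ->
    (forall j : int, (`|j| <= n)%N -> y j = z j) -> h y i = h z i) ->
  {within U, continuous h}.
Proof.
move=> H; apply/subspace_continuousP => z Uz; apply: biseq_cvg => i.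
have [n Hn] := H z Uz i.
by rewrite /= /within /=; apply: filterS (nbhs_window z n) => y /= yz Uy; apply: Hn.
Qed.

End Topology.

(** * Windows of bi-infinite words and factors of x *)

Section Factors.
Variables (A : finType) (x : nat -> A).
Implicit Types (z : biseq A) (u v w V : seq A) (i j p : int).

Definition win z i n : seq A := mkseq (fun k => z (i + k%:Z)%R : A) n.

Lemma size_win z i n : size (win z i n) = n.
Proof. exact: size_mkseq. Qed.

Lemma nth_win a z i n k : k < n -> nth a (win z i n) k = z (i + k%:Z)%R.
Proof. exact: nth_mkseq. Qed.

Lemma win_cat z i m n : win z i (m + n) = win z i m ++ win z (i + m%:Z)%R n.
Proof.
rewrite /win /mkseq iotaD map_cat add0n -[in iota m n](addn0 m) iotaDl -map_comp.
congr (_ ++ _).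
by apply: eq_map => k /=; rewrite PoszD addrA.
Qed.

Lemma bi_occurs_win z i n : bi_occurs_at z (win z i n) i.
Proof. by rewrite /bi_occurs_at size_win. Qed.

Lemma bi_occurs_cat z u v i :
  bi_occurs_at z (u ++ v) i <->
  bi_occurs_at z u i /\ bi_occurs_at z v (i + (size u)%:Z)%R.
Proof.
rewrite /bi_occurs_at -!/(win _ _ _) size_cat win_cat; split=> [e|[-> ->] //].
have := congr1 (take (size u)) e; have := congr1 (drop (size u)) e.
by rewrite !take_size_cat ?size_win // !drop_size_cat ?size_win.
Qed.

Lemma bi_occurs_prefix z u i n : bi_occurs_at z u i -> size u <= n ->
  prefix u (win z i n).
Proof.
rewrite /bi_occurs_at -/(win _ _ _) => eu le; rewrite -(subnKC le) win_cat eu.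
exact: prefix_prefix.
Qed.

Lemma bi_occurs_suffix z u i j n : bi_occurs_at z u i -> size u <= n ->
  (i + (size u)%:Z = j + n%:Z)%R -> suffix u (win z j n).
Proof.
rewrite /bi_occurs_at -/(win _ _ _) => eu le e; rewrite -(subnK le) win_cat.
have -> : (j + (n - size u)%N%:Z = i)%R by slia.
by rewrite eu suffix_suffix.
Qed.

Lemma win_infix z i j m n : (j <= i)%R -> (i + m%:Z <= j + n%:Z)%R ->
  infix (win z i m) (win z j n).
Proof.
move=> le1 le2; have -> : n = (`|(i - j)%R| + (m + `|(j + n%:Z - i - m%:Z)%R|))%N by slia.
rewrite !win_cat; have -> : (j + `|i - j|%N%:Z = i)%R by slia.
exact: infix_infix.
Qed.

Lemma bi_occurs_drop z V i k n : bi_occurs_at z V i -> k + n <= size V ->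
  win z (i + k%:Z)%R n = take n (drop k V).
Proof.
rewrite /bi_occurs_at -/(win _ _ _) => eV le.
rewrite -eV -(subnKC le) -addnA !win_cat drop_size_cat ?size_win //.
by rewrite take_size_cat ?size_win.
Qed.

Lemma bi_occurs_nth a z V i j : bi_occurs_at z V i -> (i <= j)%R ->
  (j < i + (size V)%:Z)%R -> nth a V `|j - i|%N = z j.
Proof.
rewrite /bi_occurs_at -/(win _ _ _) => eV h1 h2; rewrite -eV nth_win.
  by congr (z _); slia.
slia.
Qed.

Lemma language_infix u v : infix u v -> language x v -> language x u.
Proof.
case/infixP=> p [s ->] [i]; rewrite /occurs_at !size_cat.
rewrite /mkseq !iotaD !map_cat /= => e; exists (i + size p); rewrite /occurs_at.
have := congr1 (take (size u) \o drop (size p)) e => /=.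
rewrite !drop_size_cat ?size_map ?size_iota // !take_size_cat ?size_map ?size_iota //.
move=> eu; rewrite -[RHS]eu /mkseq add0n -[in iota (size p)](addn0 (size p)) iotaDl -map_comp.
by apply: eq_map => k /=; rewrite addnA.
Qed.

Lemma Omega_win z i n : Omega x z -> language x (win z i n).
Proof. by apply; exists i; apply: bi_occurs_win. Qed.

Lemma bi_occurs_language z u i : Omega x z -> bi_occurs_at z u i -> language x u.
Proof. by move=> Oz o; apply: Oz; exists i. Qed.

Lemma iter_shift z n i : iter n (@shift A) z i = z (i + n%:Z)%R.
Proof.
elim: n z i => [|n IH] z i; first by rewrite /= addr0.
by rewrite iterSr IH /shift; congr (z _); slia.
Qed.

Lemma bi_occurs_shift z n u i :
  bi_occurs_at (iter n (@shift A) z) u i <-> bi_occurs_at z u (i + n%:Z)%R.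
Proof.
rewrite /bi_occurs_at; have -> // : mkseq (fun k => iter n (@shift A) z (i + k%:Z)%R : A)
  (size u) = mkseq (fun k => z (i + n%:Z + k%:Z)%R : A) (size u).
by apply: eq_map => k; rewrite iter_shift; congr (z _); slia.
Qed.

Lemma Omega_shift z n : Omega x z -> Omega x (iter n (@shift A) z).
Proof.
by move=> Oz u [i /bi_occurs_shift o]; apply: Oz; exists (i + n%:Z)%R.
Qed.

End Factors.

(** * Codings by return words *)

(** Positions in the list [rs] of return words are the letters of the derived sequence, so that
    codings with respect to different words share the alphabet of natural numbers. *)
Record retdata (A : finType) (x : nat -> A) (w : seq A) (rs : seq (seq A)) :
  Prop := RetData {
  rd_neq0 : w != [::];
  rd_rec : exists K, forall V, language x V -> K <= size V -> infix w V;
  rd_uniq : uniq rs;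
  rd_mem : forall r : seq A, r \in rs <-> isret w r /\ language x (r ++ w) }.

Section Coding.
Variables (A : finType) (x : nat -> A).
Implicit Types (z : biseq A) (u v V : seq A) (d e g : seq nat).

Definition dec (rs : seq (seq A)) d : seq A :=
  flatten [seq nth [::] rs i | i <- d].

Definition valid (rs : seq (seq A)) d : bool := all (fun i => i < size rs) d.

(** The return words of [d1] end at [p] and those of [d2] start there; the closing [w] certifies
    that the last one is complete. *)
Definition coded rs w p z d1 d2 : Prop :=
  [/\ valid rs d1, valid rs d2 &
    bi_occurs_at z (dec rs d1 ++ dec rs d2 ++ w) (p - (size (dec rs d1))%:Z)%R].

Lemma dec_cat rs d e : dec rs (d ++ e) = dec rs d ++ dec rs e.
Proof. by rewrite /dec map_cat flatten_cat. Qed.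

Lemma dec1 rs i : dec rs [:: i] = nth [::] rs i.
Proof. by rewrite /dec /= cats0. Qed.

Lemma dec_rcons rs d i : dec rs (rcons d i) = dec rs d ++ nth [::] rs i.
Proof. by rewrite -cats1 dec_cat dec1. Qed.

Lemma valid_cat rs d e : valid rs (d ++ e) = valid rs d && valid rs e.
Proof. exact: all_cat. Qed.

Lemma prefix_bi_occurs z u i n : prefix u (win z i n) -> bi_occurs_at z u i.
Proof.
case/prefixP=> T e; have := bi_occurs_win z i n; rewrite e.
by case/bi_occurs_cat.
Qed.

Lemma suffix_bi_occurs z u i n : suffix u (win z i n) ->
  bi_occurs_at z u (i + n%:Z - (size u)%:Z)%R.
Proof.
case/suffixP=> T e; have := bi_occurs_win z i n; rewrite e.
case/bi_occurs_cat=> _; have := congr1 size e; rewrite size_win size_cat => ->.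
by rewrite PoszD addrA addrK.
Qed.

Section OneWord.
Variables (w : seq A) (rs : seq (seq A)).
Hypothesis RD : retdata x w rs.

Lemma valid_isret d : valid rs d -> all (isret w) [seq nth [::] rs i | i <- d].
Proof.
rewrite all_map; apply: sub_all => i /= lti.
by have /(rd_mem RD)[] := mem_nth [::] lti.
Qed.

Lemma isret_size (r : seq A) : isret w r -> 0 < size r.
Proof. by case/and3P; case: r. Qed.

Lemma size_dec d : valid rs d -> size d <= size (dec rs d).
Proof.
move/valid_isret; rewrite /dec; elim: d => //= i d IH /andP[ir /IH].
by move=> le; rewrite size_cat -add1n leq_add // (isret_size ir).
Qed.

Lemma dec_prefix d : valid rs d -> prefix w (dec rs d ++ w).
Proof. by move/valid_isret/flatten_prefix => h; apply: h; apply: prefix_refl. Qed.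

Lemma map_nth_inj d e : valid rs d -> valid rs e ->
  [seq nth [::] rs i | i <- d] = [seq nth [::] rs i | i <- e] -> d = e.
Proof.
have K d' : valid rs d' -> [seq index r rs | r <- [seq nth [::] rs i | i <- d']] = d'.
  move=> vd; rewrite -map_comp -[RHS]map_id; apply/eq_in_map => i id' /=.
  by rewrite index_uniq ?(rd_uniq RD) // (allP vd).
by move=> vd ve h; rewrite -(K d) // h K.
Qed.

Lemma next_return z p : Omega x z -> bi_occurs_at z w p ->
  exists2 i, i < size rs & bi_occurs_at z (nth [::] rs i ++ w) p.
Proof.
move=> Oz oz; have [K HK] := rd_rec RD.
set V := win z (p + 1)%R K.
have infV : infix w V by apply: HK; [exact: Omega_win|rewrite size_win].
have sw : size w <= K by have := size_infix infV; rewrite size_win.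
have eW : win z p (1 + K) = z p :: V by rewrite win_cat /win /= addr0.
have pW : prefix w (z p :: V).
  by rewrite -eW; apply: bi_occurs_prefix => //; slia.
set r := take (infix_index w V).+1 (z p :: V).
have ir : isret w r by apply: isret_take.
have prW : prefix (r ++ w) (win z p (1 + K)).
  have /prefixP[T eT] := infix_index_prefix infV.
  apply/prefixP; exists T; rewrite eW /r /=; congr (_ :: _).
  by rewrite -catA -eT cat_take_drop.
have o : bi_occurs_at z (r ++ w) p by apply: prefix_bi_occurs prW.
have rin : r \in rs.
  by apply/(rd_mem RD); split => //; apply: bi_occurs_language o.
by exists (index r rs); rewrite ?index_mem // nth_index.
Qed.

Lemma prev_return z p : Omega x z -> bi_occurs_at z w p ->
  exists2 i, i < size rs &
    bi_occurs_at z (nth [::] rs i ++ w) (p - (size (nth [::] rs i))%:Z)%R.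
Proof.
move=> Oz oz; have [K HK] := rd_rec RD.
set V := win z (p - K%:Z)%R K.
have infV : infix w V by apply: HK; [exact: Omega_win|rewrite size_win].
have [r ir] := isret_last (rd_neq0 RD) infV.
have -> : V ++ w = win z (p - K%:Z)%R (K + size w).
  by rewrite win_cat subrK; move: oz; rewrite /bi_occurs_at -/(win _ _ _) => ->.
move/suffix_bi_occurs; rewrite size_cat.
have -> : (p - K%:Z + (K + size w)%N%:Z - (size r + size w)%N%:Z = p - (size r)%:Z)%R.
  by slia.
move=> o; have rin : r \in rs.
  by apply/(rd_mem RD); split => //; apply: bi_occurs_language o.
by exists (index r rs); rewrite ?index_mem // nth_index.
Qed.

Lemma forward_code z p N : Omega x z -> bi_occurs_at z w p ->
  exists d, [/\ size d = N, valid rs d & bi_occurs_at z (dec rs d ++ w) p].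
Proof.
move=> Oz; elim: N p => [|N IH] p oz; first by exists [::].
have [i lti /bi_occurs_cat[o1 o2]] := next_return Oz oz.
have [d [sd vd od]] := IH _ o2; exists (i :: d); split; rewrite /= ?sd //.
  by rewrite lti.
by rewrite -cat1s dec_cat dec1 -catA; apply/bi_occurs_cat.
Qed.

Lemma backward_code z p N : Omega x z -> bi_occurs_at z w p ->
  exists d, [/\ size d = N, valid rs d &
    bi_occurs_at z (dec rs d ++ w) (p - (size (dec rs d))%:Z)%R].
Proof.
move=> Oz; elim: N p => [|N IH] p oz; first by exists [::]; rewrite /= subr0.
have [i lti o] := prev_return Oz oz.
have ow : bi_occurs_at z w (p - (size (nth [::] rs i))%:Z)%R.
  have : prefix w (dec rs [:: i] ++ w) by rewrite dec_prefix //= lti.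
  by case/prefixP=> T e; move: o; rewrite -dec1 e => /bi_occurs_cat[].
have [d [sd vd od]] := IH _ ow; exists (rcons d i); split.
- by rewrite size_rcons sd.
- by rewrite /valid all_rcons lti.
rewrite dec_rcons -catA size_cat; apply/bi_occurs_cat; split.
  by move/bi_occurs_cat: od => [+ _]; congr bi_occurs_at; slia.
by move: o; congr bi_occurs_at; slia.
Qed.

Lemma coded_ex z p N : Omega x z -> bi_occurs_at z w p ->
  exists d1 d2, [/\ size d1 = N, size d2 = N & coded rs w p z d1 d2].
Proof.
move=> Oz oz; have [d2 [s2 v2 o2]] := forward_code N Oz oz.
have [d1 [s1 v1 o1]] := backward_code N Oz oz.
exists d1, d2; split => //; split => //; apply/bi_occurs_cat; split.
  by move/bi_occurs_cat: o1 => [].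
by rewrite subrK.
Qed.

Lemma coded_forward z p d1 d2 : coded rs w p z d1 d2 ->
  bi_occurs_at z (dec rs d2 ++ w) p.
Proof. by case=> _ _ /bi_occurs_cat[_]; rewrite subrK. Qed.

Lemma coded_occurs z p d1 d2 : coded rs w p z d1 d2 -> bi_occurs_at z w p.
Proof.
move=> /[dup] /coded_forward o [_ v2 _]; move: o.
by case/prefixP: (dec_prefix v2) => T -> /bi_occurs_cat[].
Qed.

Lemma coded_backward z p d1 d2 : coded rs w p z d1 d2 ->
  bi_occurs_at z (dec rs d1 ++ w) (p - (size (dec rs d1))%:Z)%R.
Proof.
move=> /[dup] /coded_occurs ow [_ _ /bi_occurs_cat[o1 _]].
by apply/bi_occurs_cat; rewrite subrK.
Qed.

(** Uniqueness of codings: return words are decoded unambiguously to the right of [p] by prefixes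
    and to its left by suffixes, so a longer coding can only extend a shorter one. *)
Lemma coded_refine z p d1 d2 e1 e2 :
  coded rs w p z d1 d2 -> coded rs w p z e1 e2 ->
  size d1 <= size e1 -> size d2 <= size e2 ->
  exists g1 g2, e1 = g1 ++ d1 /\ e2 = d2 ++ g2.
Proof.
move=> cd ce le1 le2.
have [vd1 vd2 _] := cd; have [ve1 ve2 _] := ce.
have [t [e [et se]]] : exists t e, e1 = t ++ e /\ size e = size d1.
  exists (take (size e1 - size d1) e1), (drop (size e1 - size d1) e1).
  by rewrite cat_take_drop size_drop subKn.
have [f [g [fg sf]]] : exists f g, e2 = f ++ g /\ size f = size d2.
  by exists (take (size d2) e2), (drop (size d2) e2); rewrite cat_take_drop size_takel.
rewrite {}et {}fg !valid_cat in ce ve1 ve2 *.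
have [/andP[_ ve] /andP[vf vg]] := (ve1, ve2).
exists t, g; split; congr (_ ++ _); apply: map_nth_inj => //.
  have od := coded_backward cd.
  have oe : bi_occurs_at z (dec rs e ++ w) (p - (size (dec rs e))%:Z)%R.
    have := coded_backward ce; rewrite dec_cat -catA => /bi_occurs_cat[_].
    by rewrite size_cat; congr bi_occurs_at; slia.
  pose n := size (dec rs e) + size (dec rs d1) + size w.
  apply: (@flatten_suffix_inj _ w (win z (p + (size w)%:Z - n%:Z)%R n));
    rewrite ?valid_isret ?size_map // -/(dec rs _).
    by apply: bi_occurs_suffix oe _ _; rewrite size_cat /n; slia.
  by apply: bi_occurs_suffix od _ _; rewrite size_cat /n; slia.
have od := coded_forward cd.
have oe : bi_occurs_at z (dec rs f ++ w) p.
  have := coded_forward ce; rewrite dec_cat -catA.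
  by case/prefixP: (dec_prefix vg) => T ->; rewrite catA => /bi_occurs_cat[].
pose n := size (dec rs f) + size (dec rs d2) + size w.
apply: (@flatten_prefix_inj _ w (win z p n));
  rewrite ?valid_isret ?size_map // -/(dec rs _).
  by apply: bi_occurs_prefix oe _; rewrite size_cat /n; slia.
by apply: bi_occurs_prefix od _; rewrite size_cat /n; slia.
Qed.

Lemma coded_shift z p d1 i d2 : coded rs w p z d1 (i :: d2) ->
  coded rs w p (iter (size (nth [::] rs i)) (@shift A) z) (rcons d1 i) d2.
Proof.
case=> v1 /= /andP[lti v2] o; split=> //; first by rewrite /valid all_rcons lti.
apply/bi_occurs_shift; move: o; rewrite -cat1s dec_cat dec1 dec_rcons -!catA size_cat.
by congr bi_occurs_at; slia.
Qed.

Let U p : set (biseq A) := [set z | Omega x z /\ bi_occurs_at z w p].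

Lemma return_time_coded z p d1 i d2 : Omega x z -> coded rs w p z d1 (i :: d2) ->
  return_time (@shift A) (U p) z = size (nth [::] rs i).
Proof.
move=> Oz cz; set r := nth [::] rs i.
have [_ /andP[lti v2] _] := cz.
have ir : isret w r by have /(rd_mem RD)[] := mem_nth [::] lti.
have r0 := isret_size ir.
have or_ : bi_occurs_at z (r ++ w) p.
  have := coded_forward cz; rewrite -cat1s dec_cat dec1 -catA.
  by case/prefixP: (dec_prefix v2) => T ->; rewrite catA => /bi_occurs_cat[].
have Ur : U p (iter (size r) (@shift A) z).
  split; first exact: Omega_shift.
  by apply/bi_occurs_shift; move/bi_occurs_cat: or_ => [].
rewrite /return_time; case: pselect => [ex|]; last first.
  by case; exists (size r); rewrite r0 /=; apply/asboolP.
case: ex_minnP => n /andP[n0 /asboolP[_ /bi_occurs_shift on]] nmin.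
apply/eqP; rewrite eqn_leq nmin /=; last by rewrite r0; apply/asboolP.
rewrite leqNgt; apply/negP => ltn.
have := isret_next ir (_ : prefix w (drop n (r ++ w))) n0.
rewrite leqNgt ltn => h; suff: false by []. 
apply: h; rewrite prefixE; apply/eqP.
rewrite -(bi_occurs_drop or_); first by move: on; rewrite /bi_occurs_at.
by rewrite size_cat leq_add2r ltnW.
Qed.

(** Return words are nonempty, so N of them on each side of [p] reach every position within distance
    N. *)
Lemma coded_inj z1 z2 p : (forall N, exists d1 d2, [/\ N <= size d1, N <= size d2,
    coded rs w p z1 d1 d2 & coded rs w p z2 d1 d2]) -> z1 = z2.
Proof.
move=> H; apply/funext => i.
have [d1 [d2 [s1 s2 [v1 v2 c1] [_ _ c2]]]] := H (`|i| + `|p|).+1.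
have := size_dec v1; have := size_dec v2 => h2 h1.
have l1 : (p - (size (dec rs d1))%:Z <= i)%R by slia.
have l2 : (i < p - (size (dec rs d1))%:Z
    + (size (dec rs d1 ++ dec rs d2 ++ w))%:Z)%R by rewrite !size_cat; slia.
by rewrite -(bi_occurs_nth (z1 i) c1) // (bi_occurs_nth (z1 i) c2).
Qed.

(** Lengthening a coding keeps the letters already decoded, including the final [w], which is also a
    prefix of [dec rs g2 ++ w]. *)
Lemma nth_coding_refine a p g1 d1 d2 g2 i : valid rs g2 ->
  (p - (size (dec rs d1))%:Z <= i)%R -> (i < p + (size (dec rs d2 ++ w))%:Z)%R ->
  nth a (dec rs (g1 ++ d1) ++ dec rs (d2 ++ g2) ++ w)
    `|(i - (p - (size (dec rs (g1 ++ d1)))%:Z))%R|%N =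
  nth a (dec rs d1 ++ dec rs d2 ++ w) `|(i - (p - (size (dec rs d1))%:Z))%R|%N.
Proof.
move=> vg; rewrite !dec_cat !size_cat => l1 l2.
case/prefixP: (dec_prefix vg) => T eT.
rewrite -!catA eT nth_cat ifF; last by slia.
rewrite !catA nth_cat -!catA ifT; last by rewrite !size_cat; slia.
by congr nth; slia.
Qed.

End OneWord.

(** * Transport of points between cylinders with the same codings *)

Section Transfer.
Variables (w : seq A) (rs : seq (seq A)) (p : int).
Variables (w' : seq A) (rs' : seq (seq A)) (p' : int).
Hypotheses (RD : retdata x w rs) (RD' : retdata x w' rs').
Hypothesis LD : forall d, valid rs d -> language x (dec rs d ++ w) ->
  valid rs' d /\ language x (dec rs' d ++ w').

Let code z N : seq nat * seq nat :=
  xget ([::], [::]) [set d | [/\ size d.1 = N, size d.2 = N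
    & coded rs w p z d.1 d.2]].

(* The point whose sequence of return words to w' has the same indices as the
   sequence of return words to w in z. *)
Definition transfer z : biseq A := fun i : int =>
  let d := code z (`|i| + `|p'|).+1 in
  nth (z i : A) (dec rs' d.1 ++ dec rs' d.2 ++ w')
    `|(i - (p' - (size (dec rs' d.1))%:Z))%R|%N.

Let U : set (biseq A) := [set z | Omega x z /\ bi_occurs_at z w p].

Lemma codeP z N : U z -> [/\ size (code z N).1 = N, size (code z N).2 = N
  & coded rs w p z (code z N).1 (code z N).2].
Proof.
case=> Oz oz; rewrite /code; case: xgetP => [[d1 d2] _ //|h].
have [d1 [d2 H]] := coded_ex RD N Oz oz.
by case: (h (d1, d2)).
Qed.

Lemma coded_LD z d1 d2 : Omega x z -> coded rs w p z d1 d2 ->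
  [/\ valid rs' d1, valid rs' d2 & language x (dec rs' d1 ++ dec rs' d2 ++ w')].
Proof.
move=> Oz [v1 v2 o]; have := @LD (d1 ++ d2).
rewrite !valid_cat v1 v2 !dec_cat -!catA => /(_ isT).
by case=> [|/andP[]]; first exact: bi_occurs_language o.
Qed.

(** Positions of [transfer z] are decoded from codings of different lengths. Any two of them extend
    to a common longer coding, which changes no letter by [nth_coding_refine]. *)
Lemma transfer_coded z d1 d2 : U z -> coded rs w p z d1 d2 ->
  coded rs' w' p' (transfer z) d1 d2.
Proof.
move=> Uz cd; have [Oz oz] := Uz; have [v1 v2 _] := coded_LD Oz cd.
split=> //; apply: (@eq_from_nth _ (transfer z 0%R)).
  by rewrite size_mkseq.
move=> k; rewrite size_mkseq => ltk; rewrite nth_mkseq //.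
set q := (p' - (size (dec rs' d1))%:Z)%R; set i := (q + k%:Z)%R.
rewrite /transfer; set N := (_ + _).+1.
have [s1 s2 ce] := codeP N Uz; move: (code z N).1 (code z N).2 s1 s2 ce => e1 e2 s1 s2 ce.
have [ve1 ve2 _] := coded_LD Oz ce.
have [f1 [f2 [t1 t2 cf]]] := coded_ex RD (N + size d1 + size d2) Oz oz.
have [vf1 vf2 _] := coded_LD Oz cf.
have [||g1 [g2 [h1 h2]]] := coded_refine RD cd cf; [slia|slia|].
have [||g3 [g4 [h3 h4]]] := coded_refine RD ce cf; [slia|slia|].
have vg2 : valid rs' g2 by move: vf2; rewrite h2 valid_cat => /andP[].
have vg4 : valid rs' g4 by move: vf2; rewrite h4 valid_cat => /andP[].
have b1 := size_dec RD' ve1; have b2 := size_dec RD' ve2.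
rewrite !size_cat in ltk.
rewrite -(nth_coding_refine RD' _ g3 vg4) ?size_cat; [|slia|slia].
rewrite -h3 -h4 h1 h2 (nth_coding_refine RD' _ g1 vg2) ?size_cat; [|slia|slia].
rewrite -/q (_ : (i - q = k%:Z)%R); last by slia.
by apply: set_nth_default; rewrite !size_cat.
Qed.

Lemma transfer_in z : U z -> Omega x (transfer z) /\ bi_occurs_at (transfer z) w' p'.
Proof.
move=> Uz; have [Oz oz] := Uz; split; last first.
  have [d1 [d2 [_ _ /(transfer_coded Uz)]]] := coded_ex RD 0 Oz oz.
  exact: coded_occurs.
move=> u [i ou].
have [d1 [d2 [s1 s2 cd]]] := coded_ex RD (`|i| + `|p'| + size u).+1 Oz oz.
have [v1 v2 Lw] := coded_LD Oz cd; apply: language_infix Lw.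
have [_ _] := transfer_coded Uz cd; move: ou; rewrite /bi_occurs_at -!/(win _ _ _).
have b1 := size_dec RD' v1; have b2 := size_dec RD' v2.
move=> eu ew; rewrite -eu -ew; apply: win_infix; rewrite ?size_cat; slia.
Qed.

(** The finitely many indices used at position [i] are read in a finite window of [z], and a point
    that agrees with [z] there has the same ones by [coded_refine]. *)
Lemma transfer_continuous : {within U, continuous transfer}.
Proof.
apply: biseq_continuous => z Uz i; set N := (`|i| + `|p'|).+1.
have [s1 s2 cd] := codeP N Uz; have [v1 v2 o] := cd.
set V := _ ++ _ in o; set q := (_ - _)%R in o.
exists (`|q| + size V + `|i|) => y Uy yz.
have oy : bi_occurs_at y V q.
  move: o; rewrite /bi_occurs_at => oz; rewrite -[RHS]oz.
  apply/eq_in_map => k; rewrite mem_iota => /andP[_ ltk].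
  by apply: yz; slia.
have cy : coded rs w p y (code z N).1 (code z N).2 by split.
have [t1 t2 cy'] := codeP N Uy.
have [||g1 [g2 [e1 e2]]] := coded_refine RD cy cy'; [slia|slia|].
have g10 : g1 = [::].
  by apply/nilP; rewrite /nilp; have := congr1 size e1; rewrite size_cat; slia.
have g20 : g2 = [::].
  by apply/nilP; rewrite /nilp; have := congr1 size e2; rewrite size_cat; slia.
rewrite g10 g20 cats0 /= in e1 e2.
by rewrite /transfer -/N e1 e2 yz //; slia.
Qed.

End Transfer.

Lemma transferK w rs p w' rs' p' (RD : retdata x w rs) (RD' : retdata x w' rs')
    (LD : forall d, valid rs d -> language x (dec rs d ++ w) ->
      valid rs' d /\ language x (dec rs' d ++ w'))
    (LD' : forall d, valid rs' d -> language x (dec rs' d ++ w') ->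
      valid rs d /\ language x (dec rs d ++ w)) z :
  Omega x z -> bi_occurs_at z w p ->
  transfer w' rs' p' w rs p (transfer w rs p w' rs' p' z) = z.
Proof.
move=> Oz oz; apply: (@coded_inj w rs RD _ _ p) => N.
have [d1 [d2 [s1 s2 cd]]] := coded_ex RD N Oz oz.
exists d1, d2; rewrite s1 s2; split => //.
apply: (transfer_coded p RD' RD LD') => //.
  exact: (transfer_in p' RD RD' LD (conj Oz oz)).
exact: (transfer_coded p' RD RD' LD).
Qed.

(** The induced map carries one index across the origin of the coding, for [w] as for [w']; only the
    lengths of the shifts differ. *)
Lemma transfer_induced w rs p w' rs' p' (RD : retdata x w rs) (RD' : retdata x w' rs')
    (LD : forall d, valid rs d -> language x (dec rs d ++ w) ->
      valid rs' d /\ language x (dec rs' d ++ w'))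
    z : Omega x z -> bi_occurs_at z w p ->
  transfer w rs p w' rs' p'
    (induced (@shift A) [set z | Omega x z /\ bi_occurs_at z w p] z) =
  induced (@shift A) [set z | Omega x z /\ bi_occurs_at z w' p']
    (transfer w rs p w' rs' p' z).
Proof.
move=> Oz oz; have Uz := conj Oz oz; apply: (@coded_inj w' rs' RD' _ _ p') => N.
have [d1 [d2 [s1 s2 cd]]] := coded_ex RD N.+1 Oz oz.
case: d2 s2 cd => // i d2 [s2] cd.
have cd' := transfer_coded p' RD RD' LD Uz cd.
have [Oz' oz'] := transfer_in p' RD RD' LD Uz.
exists (rcons d1 i), d2; rewrite size_rcons s1 s2; split => //; first by slia.
  2: by rewrite /induced (return_time_coded RD' Oz' cd'); apply: coded_shift.
have ci := coded_shift cd.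
apply: (transfer_coded p' RD RD' LD).
  rewrite /induced (return_time_coded RD Oz cd); split; first exact: Omega_shift.
  exact: (coded_occurs RD ci).
by rewrite /induced (return_time_coded RD Oz cd).
Qed.

Lemma conjugate_same_codes u v rs u' v' rs' :
  retdata x (u ++ v) rs -> retdata x (u' ++ v') rs' ->
  (forall d, valid rs d /\ language x (dec rs d ++ u ++ v) <->
     valid rs' d /\ language x (dec rs' d ++ u' ++ v')) ->
  conjugate (cylinder x u v) (induced (@shift A) (cylinder x u v))
    (cylinder x u' v') (induced (@shift A) (cylinder x u' v')).
Proof.
move=> RD RD' LD.
have LD1 d : valid rs d -> language x (dec rs d ++ u ++ v) ->
    valid rs' d /\ language x (dec rs' d ++ u' ++ v').
  by move=> h1 h2; apply/LD.
have LD2 d : valid rs' d -> language x (dec rs' d ++ u' ++ v') ->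
    valid rs d /\ language x (dec rs d ++ u ++ v).
  by move=> h1 h2; apply/LD.
pose p : int := (- (size u)%:Z)%R; pose p' : int := (- (size u')%:Z)%R.
exists (transfer (u ++ v) rs p (u' ++ v') rs' p'),
  (transfer (u' ++ v') rs' p' (u ++ v) rs p); split.
- move=> z [Oz oz]; split; last exact: transferK.
  exact: (transfer_in p' RD RD' LD1 (conj Oz oz)).
- move=> z [Oz oz]; split; last exact: transferK.
  exact: (transfer_in p RD' RD LD2 (conj Oz oz)).
- exact: transfer_continuous.
- exact: transfer_continuous.
- by move=> z [Oz oz]; apply: transfer_induced.
Qed.

End Coding.

(** * Finiteness from comparable block decompositions *)

Lemma finite_representatives (X : eqType) (T : finType) (P : X -> Prop) (ty : X -> T) :
  exists reps : seq X, (forall p, p \in reps -> P p) /\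
    (forall p, P p -> exists q, [/\ q \in reps, P q & ty q = ty p]).
Proof.
suff H (s : seq T) : exists reps : seq X, (forall p, p \in reps -> P p) /\
    (forall p, P p -> ty p \in s -> exists q, [/\ q \in reps, P q & ty q = ty p]).
  have [reps [h1 h2]] := H (enum T); exists reps; split=> // p Pp.
  by apply: h2; rewrite ?mem_enum.
elim: s => [|t s [reps [h1 h2]]]; first by exists [::].
have [[p0 [Pp0 e0]]|n0] := pselect (exists p, P p /\ ty p = t).
  exists (p0 :: reps); split=> [p|p Pp]; rewrite inE.
    by case/orP => [/eqP ->|/h1].
  case/orP => [/eqP e|/(h2 _ Pp)[q [qr Pq e]]].
    by exists p0; rewrite mem_head e0 e.
  by exists q; rewrite inE qr orbT.
exists reps; split=> // p Pp; rewrite inE => /orP[/eqP e|]; last exact: h2.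
by case: n0; exists p.
Qed.

Lemma insub_bseqK (T : Type) n (u : seq T) : size u <= n ->
  bseqval (insub_bseq n u) = u.
Proof. by move=> le; rewrite /insub_bseq insubdK. Qed.

(** * Uniform recurrence, periodicity and lengths of return words *)

Section Recurrence.
Variables (A : finType) (x : nat -> A).
Hypothesis x_ur : uniformly_recurrent x.

Definition periodic : Prop := exists2 p, 0 < p & forall i, x (i + p) = x i.

Lemma language_mkseq i n : language x (mkseq (fun k => x (i + k)) n).
Proof. by exists i; rewrite /occurs_at size_mkseq. Qed.

Lemma language_recurrent w : language x w ->
  exists G, forall V, language x V -> G <= size V -> infix w V.
Proof.
move=> /x_ur[g Hg]; exists (g + size w) => V [n <-]; rewrite size_mkseq => le.
have [i /andP[ni ing] <-] := Hg n.
have -> : size V = (i - n) + (size w + (size V - size w - (i - n))) by slia.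
rewrite /mkseq !iotaD !map_cat add0n; apply: infix_catl; apply: infix_catr.
rewrite -[in iota (i - n) _](addn0 (i - n)) iotaDl -map_comp.
rewrite [X in infix X _](_ : _ = [seq x (n + (i - n + k)) | k <- iota 0 (size w)]).
  exact: infix_refl.
by apply: eq_map => k; congr x; slia.
Qed.

Lemma periodicP (p : nat) : 0 < p ->
  (forall (w : seq A) a, language x w -> size w = p.+1 -> nth a w 0 = nth a w p) -> periodic.
Proof.
move=> p0 H; exists p => // i.
have := H _ (x 0) (language_mkseq i p.+1).
by rewrite size_mkseq !nth_mkseq // addn0 => ->.
Qed.

(** By uniform recurrence a factor of length [(size t).+1] occurs in a high power of [t], where
    letters at distance [size t] agree. *)
Lemma power_periodic (t : seq A) : t != [::] ->
  (forall n, language x (flatten (nseq n t))) -> periodic.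
Proof.
move=> t0 H; have p0 : 0 < size t by rewrite lt0n size_eq0.
apply: (periodicP p0) => w a Lw sw.
have [G HG] := language_recurrent Lw.
have szp n : size (flatten (nseq n t)) = n * size t.
  by elim: n => //= n IH; rewrite size_cat IH mulSn.
have per n j : j + size t < n * size t ->
    nth a (flatten (nseq n t)) (j + size t) = nth a (flatten (nseq n t)) j.
  elim: n j => // n IH j; rewrite mulSn => lt; rewrite /= nth_cat ifF; last by slia.
  rewrite addnK nth_cat; case: ltnP => h; last first.
    by rewrite -{1}(subnK h) IH //; slia.
  by case: n lt {IH} => [|n] lt; [slia|rewrite /= nth_cat h].
have : infix w (flatten (nseq G t)).
  by apply: HG => //; rewrite szp leq_pmulr.
case/infixP=> X [Y e].
have lt : size X + size t < G * size t.
  by rewrite -szp e !size_cat sw ltn_add2l addSn ltnS leq_addr.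
have := per G (size X) lt; rewrite e nth_cat ifF ?ltnNge ?leq_addr //.
rewrite nth_cat addKn sw ltnSn => ->; rewrite nth_cat ltnn subnn nth_cat sw.
by [].
Qed.

(* If a long word w has a return word of length p with size w >= K * p.+1, then
   every factor of length p.+1 occurs in a word of period p. *)
Lemma return_lower_bound K (w r : seq A) : ~ periodic ->
  (forall n (v V : seq A), 0 < n -> language x v -> size v <= n -> language x V ->
     K * n <= size V -> infix v V) ->
  isret w r -> language x (r ++ w) -> size w <= 2 * K * size r.
Proof.
move=> aper LR /[dup] ir /isret_size r0 Lrw; rewrite leqNgt; apply/negP => lt.
apply: aper; apply: (periodicP r0) => v a Lv sv.
have leK : K * (size r).+1 <= size (r ++ w).
  rewrite size_cat; apply: leq_trans (leq_addl _ _).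
  apply: leq_trans (ltnW lt); rewrite (mulnC 2) -mulnA leq_mul2l.
  by rewrite mul2n -addnn -addn1 leq_add2l r0 orbT.
have /infix_ex [X [Y e]] := LR _ v (r ++ w) (ltn0Sn _) Lv (eq_leq sv) Lrw leK.
have sX : size X < size w.
  by have := congr1 size e; rewrite !size_cat sv; slia.
have eX k : k < size v -> nth a v k = nth a (r ++ w) (size X + k).
  by move=> h; rewrite e nth_cat ifF ?addKn ?nth_cat ?h //; slia.
rewrite !eX ?sv // addn0 [RHS]nth_cat ifF; last by slia.
rewrite addnK; case/and3P: ir => _ /prefixP[T ->] _.
by rewrite nth_cat sX.
Qed.

(** Were [r ++ w] longer, deleting its first and last letters would leave a word that still contains
    [w], an occurrence strictly between the two at its ends. *)
Lemma return_upper_bound G (w r : seq A) : w != [::] ->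
  (forall V, language x V -> G <= size V -> infix w V) ->
  isret w r -> language x (r ++ w) -> size (r ++ w) <= G + size w.
Proof.
move=> w0 HG ir Lrw; rewrite leqNgt; apply/negP => lt.
have n0 : 0 < size w by rewrite lt0n size_eq0.
case: r ir Lrw lt => [|c r]; first by case/and3P.
case/and3P => _ _ /eqP /= id Lrw; rewrite size_cat => lt.
pose Y := take (size r + size w).-1 (r ++ w).
have sY : size Y = (size r + size w).-1 by rewrite size_takel // size_cat; slia.
have infY : infix w Y.
  apply: HG; last by rewrite sY; slia.
  apply: language_infix Lrw; apply: infix_trans (infix_take _ _) _.
  exact: infix_cons.
have le : infix_index w Y + size w <= size Y.
  have h1 : size w <= size Y - infix_index w Y.
    by rewrite -size_drop; apply: size_prefix; apply: infix_index_prefix.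
  have h2 : infix_index w Y <= size Y by rewrite infixTindex.
  by slia.
have := infix_index_cat (drop (size r + size w).-1 (r ++ w)) infY.
by rewrite cat_take_drop id; slia.
Qed.

End Recurrence.

(* For every scale n, x is covered by blocks psi b of length at most C * n whose
   order of succession is constrained by F only, and q1 successive blocks have
   total length at least n. *)
Record frame (A : finType) (x : nat -> A) (B : finType) (F : set (seq B))
    (C q1 : nat) : Prop := Frame {
  F_infix : forall u v : seq B, infix u v -> F v -> F u;
  F_unbounded : forall N, exists2 u, F u & N <= size u;
  F_ur : forall u, F u -> exists g, forall v : seq B, F v -> g <= size v -> infix u v;
  F_blocks : forall n, 0 < n -> exists psi : B -> seq A,
    [/\ forall b, psi b != [::], forall u, F u -> language x (sub psi u),
        forall b, F [:: b] -> size (psi b) <= C * n &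
        forall v, F v -> q1 <= size v -> n <= size (sub psi v)] }.

(** * Linear recurrence and bounds uniform in w from a frame *)

Section FrameTheory.
Variables (A : finType) (x : nat -> A) (B : finType) (F : set (seq B)).
Variables (C q1 : nat).
Hypothesis x_ur : uniformly_recurrent x.
Hypothesis FR : frame x F C q1.

Lemma F_mem u b : F u -> b \in u -> F [:: b].
Proof. by move=> Fu bu; apply: (F_infix FR) Fu; rewrite infix1s. Qed.

Lemma F_ur_uniform m : exists g, forall u v : seq B, F u -> size u <= m ->
  F v -> g <= size v -> infix u v.
Proof.
have /choice[g Hg] : forall t : m.-bseq B, exists g, F t ->
    forall v : seq B, F v -> g <= size v -> infix t v.
  move=> t; have [/(F_ur FR)[g Hg]|nF] := pselect (F t); first by exists g.
  by exists 0.
exists (\max_(t : m.-bseq B) g t) => u v Fu su Fv sv.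
apply: (Hg (Bseq su)) => //; apply: leq_trans sv.
exact: (@leq_bigmax _ g (Bseq su)).
Qed.

Lemma language_in_blocks (psi : B -> seq A) : (forall b, psi b != [::]) ->
  (forall u, F u -> language x (sub psi u)) ->
  forall w m, language x w -> exists u, [/\ F u, m <= size u & infix w (sub psi u)].
Proof.
move=> psi0 psiL w m /(language_recurrent x_ur)[G HG].
have [u Fu su] := F_unbounded FR (maxn m G); exists u; split=> //.
  exact: leq_trans (leq_maxl _ _) su.
apply: HG; first exact: psiL.
apply: leq_trans (size_sub_ge u psi0).
exact: leq_trans (leq_maxr _ _) su.
Qed.

Lemma linear_recurrence : exists2 K, 0 < K & forall n (v V : seq A), 0 < n ->
  language x v -> size v <= n -> language x V -> K * n <= size V -> infix v V.
Proof.
(* A word of length at most [n] meets at most [q1] inner blocks and two outer ones. A word of length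
   [C.+1 * (g + 2) * n] meets at least [g + 2] blocks of length at most [C * n], so it contains at
   least [g] whole ones; [C.+1] in place of [C] makes the inequality strict. *)
have [g Hg] := F_ur_uniform (q1 + 2); exists (C.+1 * (g + 2)).
  by rewrite muln_gt0 addn2.
move=> n v V n0 Lv sv LV sV; have [psi [psi0 psiL psiC psiq]] := F_blocks FR n0.
have [u [Fu _ /sub_cover[u' [u'u vu' cv]]]] := language_in_blocks psi0 psiL 0 Lv.
have Fu' : F u' by apply: (F_infix FR) u'u Fu.
have su' : size u' <= q1 + 2.
  case: cv => [|[b [t [b' [X [Z [eu' ev _ _]]]]]]]; first by slia.
  have Ft : F t.
    apply: (F_infix FR) Fu'; rewrite eu' -cats1 -cat1s; exact: infix_infix.
  rewrite eu' /= size_rcons; suff: size t <= q1 by slia.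
  (* Without [c] there remain [q1] blocks of total length at least [n]; the nonempty [psi c] then
     pushes [v] beyond [n]. *)
  rewrite leqNgt; apply/negP => lt; case: t lt Ft ev {eu'} => // c t lt Ft ev.
  have Ft' : F t by apply: (F_infix FR) Ft; apply: infix_cons.
  have h1 := psiq _ Ft' lt; have h2 := psi0 c.
  have h3 : size v = size X + (size (psi c) + size (sub psi t) + size Z).
    by rewrite ev sub_cons !size_cat.
  have h4 : 0 < size (psi c) by rewrite lt0n size_eq0.
  slia.
have [U [FU _ /sub_cover[U' [U'U VU' cV]]]] := language_in_blocks psi0 psiL 0 LV.
have FU' : F U' by apply: (F_infix FR) U'U FU.
have sU' : g + 2 <= size U'.
  have : size V <= size U' * (C * n).
    apply: leq_trans (size_infix VU') _; apply: size_sub_le => b bU.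
    by apply: psiC; apply: F_mem bU.
  move=> h; rewrite leqNgt; apply/negP => lt.
  have := leq_trans sV h; rewrite leqNgt => /negP; apply.
  apply: (@leq_trans (((g + 2) * (C * n)).+1)).
    by rewrite ltnS leq_mul2r ltnW ?orbT.
  by rewrite (mulnC _ (g + 2)) -mulnA ltn_mul2l mulSn; slia.
case: cV => [|[b [t [b' [X [Z [eU' -> _ _]]]]]]]; first by slia.
apply: infix_trans vu' _; apply: infix_catl; apply: infix_catr; apply: infix_sub.
have Ft : F t.
  apply: (F_infix FR) FU'; rewrite eU' -cats1 -cat1s; exact: infix_infix.
by apply: Hg => //; move: sU'; rewrite eU' /= size_rcons; slia.
Qed.

Lemma size_sub_blocks (psi : B -> seq A) n K v :
  (forall v, F v -> q1 <= size v -> n <= size (sub psi v)) ->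
  F v -> K * q1 <= size v -> K * n <= size (sub psi v).
Proof.
move=> h; elim: K v => // K IH v Fv sv; rewrite mulSn in sv.
rewrite -(cat_take_drop q1 v) sub_cat size_cat mulSn.
have F1 : F (take q1 v) by apply: (F_infix FR) Fv; apply: infix_take.
have F2 : F (drop q1 v) by apply: (F_infix FR) Fv; apply: infix_drop.
apply: leq_add; first by apply: h => //; rewrite size_takel //; slia.
by apply: IH => //; rewrite size_drop; slia.
Qed.

(** Here [psi] and [rs] may vary with [w], while [Q], [M] and [m0] are to be chosen once for all
    words, so that the local rules live in one finite type. *)
Record blockcoding (w : seq A) (Q M m0 : nat) (psi : B -> seq A)
    (rs : seq (seq A)) : Prop := BlockCoding {
  bc_ret : retdata x w rs;
  bc_size : size rs <= m0;
  bc_neq0 : forall b, psi b != [::];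
  bc_lang : forall u, F u -> language x (sub psi u);
  bc_occ : forall v, F v -> Q <= size v -> infix w (sub psi v);
  bc_rets : forall u, F u -> size u <= Q.+1 -> size (rets w (sub psi u)) <= M }.

Lemma blockcoding_ex : ~ periodic x -> exists Q M m0, forall w, language x w ->
  w != [::] -> exists psi rs, blockcoding w Q M m0 psi rs.
Proof.
move=> aper; have [K K0 LR] := linear_recurrence.
(* At scale [size w], [K * q1] blocks have length at least [K * size w] and so contain [w]. As
   [size w <= 2 * K * size r] for a return word [r], the length of [(K * q1).+1] blocks bounds the
   returns in them, whence [M]. All return words occur in [V0], of length [K * (K.+1 * size w)],
   because [size (r ++ w) <= K.+1 * size w]; the same count in [V0] gives [m0]. *)
exists (K * q1), (2 * K * ((K * q1).+1 * C)), (2 * K * (K * K.+1)) => w Lw w0.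
have n0 : 0 < size w by rewrite lt0n size_eq0.
have [psi [psi0 psiL psiC psiq]] := F_blocks FR n0.
pose V0 := mkseq x (K * (K.+1 * size w)).
have LV0 : language x V0 by apply: (language_mkseq x 0).
have sV0 : size V0 = K * (K.+1 * size w) by rewrite size_mkseq.
have bound V : language x V -> size (rets w V) * size w <= 2 * K * size V.
  move=> LV; have [infV|ninf] := boolP (infix w V); last by rewrite rets_nil.
  rewrite mulnC; apply: leq_trans (_ : 2 * K * size (flatten (rets w V)) <= _).
    apply: size_flatten_ge => r rin; apply: (return_lower_bound aper LR).
      exact: (allP (rets_all w V)).
    have := infix_flatten_rets infV (_ : infix [:: r] _); rewrite infix1s => /(_ rin).
    by rewrite /= cats0 => h; apply: language_infix LV.
  by rewrite leq_mul2l size_flatten_rets orbT.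
have infV0 : infix w V0.
  by apply: (LR (size w)) => //; rewrite sV0 leq_mul2l leq_pmull ?orbT.
exists psi, (undup (rets w V0)); split=> //.
- split=> //.
  + by exists (K * size w) => V LV sV; apply: (LR (size w)).
  + exact: undup_uniq.
  move=> r; rewrite mem_undup; split=> [rin|[ir Lr]].
    split; first exact: (allP (rets_all w V0)).
    have := infix_flatten_rets infV0 (_ : infix [:: r] _); rewrite infix1s => /(_ rin).
    by rewrite /= cats0 => h; apply: language_infix LV0.
  rewrite -infix1s; apply: infix_rets_flatten; first by rewrite /= ir.
  rewrite /= cats0; apply: (LR (K.+1 * size w)) => //; first by rewrite muln_gt0.
    rewrite mulSnr; apply: (return_upper_bound w0 _ ir Lr).
    by move=> V LV sV; apply: (LR (size w)).
  by rewrite sV0.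
- apply: leq_trans (size_undup _) _; have := bound _ LV0.
  by rewrite sV0 !mulnA leq_pmul2r.
- move=> v Fv sv; apply: (LR (size w)) => //; first exact: psiL.
  exact: size_sub_blocks sv.
- move=> u Fu su; have := bound _ (psiL _ Fu).
  have h : size (sub psi u) <= (K * q1).+1 * (C * size w).
    apply: leq_trans (_ : size u * (C * size w) <= _).
      by apply: size_sub_le => b bu; apply: psiC; apply: F_mem bu.
    by rewrite leq_mul2r su orbT.
  move=> h2; have := leq_trans h2 (_ : _ <= 2 * K * ((K * q1).+1 * (C * size w))).
  by rewrite leq_mul2l h orbT => /(_ isT); rewrite !mulnA leq_pmul2r.
Qed.

(** * Local rules: indices of return words read along blocks *)

Definition codes (w : seq A) (psi : B -> seq A) (rs : seq (seq A)) (u : seq B) :=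
  [seq index r rs | r <- rets w (sub psi u)].

Lemma codes_catl w psi rs b v : infix w (sub psi v) ->
  exists D, forall v', codes w psi rs (b :: v ++ v') = D ++ codes w psi rs (v ++ v').
Proof.
move=> inf; have [D HD] := rets_catl (psi b) inf.
exists [seq index r rs | r <- D] => v'.
by rewrite /codes sub_cons sub_cat HD map_cat.
Qed.

Section Comparison.
Variables (Q M m0 : nat).

Lemma codes_rets w psi rs u : blockcoding w Q M m0 psi rs -> F u ->
  valid rs (codes w psi rs u) /\
  [seq nth [::] rs i | i <- codes w psi rs u] = rets w (sub psi u).
Proof.
move=> bc Fu; have LV := bc_lang bc Fu.
have rin r : r \in rets w (sub psi u) -> r \in rs.
  move=> rin; apply/(rd_mem (bc_ret bc)).
  split; first exact: (allP (rets_all w (sub psi u))).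
  have infV : infix w (sub psi u).
    by apply: contraTT rin => h; rewrite rets_nil.
  have := infix_flatten_rets infV (_ : infix [:: r] _); rewrite infix1s => /(_ rin).
  by rewrite /= cats0 => h; apply: language_infix LV.
split; first by rewrite /valid all_map; apply/allP => r /rin; rewrite /= index_mem.
rewrite -map_comp -[RHS]map_id; apply/eq_in_map => r /rin h /=.
by rewrite nth_index.
Qed.

(** Reduces the comparison of two languages of codings to the comparison of [codes] on the common
    language [F]. The bound [Q] ensures that [w] occurs in the image, so that [rets] can be read
    back as a factor of it. *)
Lemma codes_LD w psi rs d : blockcoding w Q M m0 psi rs -> d != [::] ->
  valid rs d /\ language x (dec rs d ++ w) <->
  exists u, [/\ F u, Q <= size u & infix d (codes w psi rs u)].
Proof.
move=> bc d0; split=> [[vd Ld]|[u [Fu su inf]]].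
  have [u [Fu su inf]] := language_in_blocks (bc_neq0 bc) (bc_lang bc) Q Ld.
  exists u; split=> //.
  have /infixP[X [Y e]] := infix_rets_flatten (valid_isret (bc_ret bc) vd) inf.
  rewrite /codes e !map_cat -map_comp; apply: infix_catl; apply: infix_catr.
  rewrite [X in infix X _](_ : _ = [seq (index^~ rs \o nth [::] rs) i | i <- d]).
    exact: infix_refl.
  rewrite -[LHS]map_id; apply/eq_in_map => i id' /=.
  by rewrite index_uniq ?(rd_uniq (bc_ret bc)) // (allP vd).
have [vc ec] := codes_rets bc Fu; case/infixP: inf => X [Y e].
have vd : valid rs d by move: vc; rewrite e !valid_cat => /and3P[].
split=> //; apply: language_infix (bc_lang bc Fu).
apply: infix_flatten_rets; first exact: (bc_occ bc).
by rewrite -ec e !map_cat infix_infix.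
Qed.

(** The local rule as an element of a finite type. On words of [F] the truncations lose nothing, by
    [bc_rets] and [bc_size]. *)
Definition profile w psi rs : {ffun (Q.+1).-bseq B -> M.-bseq 'I_m0.+1} :=
  [ffun u : (Q.+1).-bseq B => insub_bseq M [seq inord i | i <- codes w psi rs u]].

(** The indices due to the first letter [b] are those of [b :: v] with those of [v] removed, where
    [v] is the word of the next [Q] letters. Both words are short enough for the profile, and
    induction treats the rest. *)
Lemma profile_codes w psi rs w' psi' rs' :
  blockcoding w Q M m0 psi rs -> blockcoding w' Q M m0 psi' rs' ->
  profile w psi rs = profile w' psi' rs' ->
  forall u, F u -> Q <= size u -> codes w psi rs u = codes w' psi' rs' u.
Proof.
move=> bc bc' ep.
have K w1 psi1 rs1 u : blockcoding w1 Q M m0 psi1 rs1 -> F u -> size u <= Q.+1 ->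
  [seq nat_of_ord i | i <- bseqval
    (insub_bseq M [seq (inord i : 'I_m0.+1) | i <- codes w1 psi1 rs1 u])]
    = codes w1 psi1 rs1 u.
  move=> bc1 Fu su; have [vc _] := codes_rets bc1 Fu.
  rewrite insub_bseqK; last by rewrite !size_map; apply: (bc_rets bc1).
  rewrite -map_comp -[RHS]map_id; apply/eq_in_map => i id' /=.
  by rewrite inordK //; have := allP vc _ id'; have := bc_size bc1; slia.
have short u : F u -> size u <= Q.+1 -> codes w psi rs u = codes w' psi' rs' u.
  move=> Fu su; rewrite -(K _ _ _ _ bc Fu su) -(K _ _ _ _ bc' Fu su).
  by move/ffunP: ep => /(_ (Bseq su)); rewrite !ffunE /= => ->.
elim=> [|b u IH] Fu su; first exact: short.
have [le|gt] := leqP (size u) Q; first exact: short.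
have Fu' : F u by apply: (F_infix FR) Fu; apply: infix_cons.
pose v := take Q u; pose v' := drop Q u.
have eu : u = v ++ v' by rewrite cat_take_drop.
have sv : size v = Q by rewrite size_takel // ltnW.
have Fv : F v by apply: (F_infix FR) Fu'; apply: infix_take.
have Fbv : F (b :: v).
  by apply: (F_infix FR) Fu; rewrite eu -cat_cons prefix_infix.
have [|D HD] := @codes_catl w psi rs b v; first by apply: (bc_occ bc); rewrite ?sv.
have [|D' HD'] := @codes_catl w' psi' rs' b v.
  by apply: (bc_occ bc'); rewrite ?sv.
have eD : D = D'.
  have := HD [::]; have := HD' [::]; rewrite !cats0.
  have -> : codes w psi rs (b :: v) = codes w' psi' rs' (b :: v).
    by apply: short; rewrite //= sv.
  have -> : codes w psi rs v = codes w' psi' rs' v by apply: short; rewrite // sv.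
  move=> -> e.
  have se : size D = size D'.
    by have := congr1 size e; rewrite !size_cat => /addIn.
  by have := congr1 (take (size D)) e; rewrite take_size_cat ?se // take_size_cat.
by rewrite eu HD HD' eD -eu IH // ltnW.
Qed.

Lemma profile_conjugate u v psi rs u' v' psi' rs' :
  blockcoding (u ++ v) Q M m0 psi rs -> blockcoding (u' ++ v') Q M m0 psi' rs' ->
  language x (u ++ v) -> language x (u' ++ v') ->
  profile (u ++ v) psi rs = profile (u' ++ v') psi' rs' ->
  conjugate (cylinder x u v) (induced (@shift A) (cylinder x u v))
    (cylinder x u' v') (induced (@shift A) (cylinder x u' v')).
Proof.
move=> bc bc' Lw Lw' ep; have ec := profile_codes bc bc' ep.
apply: conjugate_same_codes (bc_ret bc) (bc_ret bc') _ => d.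
have [->|d0] := eqVneq d [::]; first by split=> _; split.
rewrite (codes_LD bc d0) (codes_LD bc' d0).
split=> -[t [Ft st inf]]; exists t; split=> //; first by rewrite -ec.
by rewrite ec.
Qed.

End Comparison.

Lemma frame_finitely_many : ~ periodic x ->
  exists reps : seq (seq A * seq A),
    (forall p, p \in reps -> cylinder x p.1 p.2 !=set0) /\
    (forall u v : seq A, cylinder x u v !=set0 ->
      exists2 p, p \in reps &
        conjugate (cylinder x u v) (induced (@shift A) (cylinder x u v))
          (cylinder x p.1 p.2) (induced (@shift A) (cylinder x p.1 p.2))).
Proof.
move=> aper; have [Q [M [m0 H]]] := blockcoding_ex aper.
have H' w : exists d : (B -> seq A) * seq (seq A), language x w -> w != [::] ->
    blockcoding w Q M m0 d.1 d.2.
  have [[Lw w0]|n] := pselect (language x w /\ w != [::]).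
    by have [psi [rs bc]] := H w Lw w0; exists (psi, rs).
  by exists (fun _ => [::], [::]) => Lw w0; case: n.
have [c Hc] := choice H'.
(* [blockcoding] needs a nonempty word. The empty word arises from a single cylinder, the whole of
   [Omega x], and gets a type of its own. *)
pose ty (p : seq A * seq A) := let w := p.1 ++ p.2 in
  if w == [::] then None else Some (profile Q M m0 w (c w).1 (c w).2).
have [reps [r1 r2]] := finite_representatives
  (fun p : seq A * seq A => cylinder x p.1 p.2 !=set0) ty.
exists reps; split=> // u v cuv.
have Lcyl u1 v1 : cylinder x u1 v1 !=set0 -> language x (u1 ++ v1).
  by case=> z [Oz oz]; apply: bi_occurs_language oz.
have [[u' v'] [qr Pq eq]] := r2 (u, v) cuv; exists (u', v') => //=.
rewrite /= in Pq; move: eq; rewrite /ty /=.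
case: ifPn => [/eqP e'|n']; case: ifPn => [/eqP e|n] //.
  have -> : u = u' by case: (u) (u') e e' => [|? ?] [|? ?].
  have -> : v = v' by case: (v) (v') (u) (u') e e' => [|? ?] [|? ?] [|? ?] [|? ?].
  by exists id, id; split=> //; apply: continuous_subspaceT => ? ?; exact: cvg_id.
move=> [] /esym ep; have Lw := Lcyl _ _ cuv; have Lw' := Lcyl _ _ Pq.
exact: profile_conjugate (Hc _ Lw n) (Hc _ Lw' n') Lw Lw' ep.
Qed.

End FrameTheory.

(** * The periodic case *)

Lemma periodic_finitely_many (A : finType) (x : nat -> A) : periodic x ->
  exists reps : seq (seq A * seq A),
    (forall p, p \in reps -> cylinder x p.1 p.2 !=set0) /\
    (forall u v : seq A, cylinder x u v !=set0 ->
      exists2 p, p \in reps &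
        conjugate (cylinder x u v) (induced (@shift A) (cylinder x u v))
          (cylinder x p.1 p.2) (induced (@shift A) (cylinder x p.1 p.2))).
Proof.
case=> p p0 px.
have pz z (i : int) : Omega x z -> z (i + p%:Z)%R = z i.
  move=> Oz; have [n] := Omega_win i p.+1 Oz; rewrite /occurs_at size_win => e.
  have /(congr1 (fun s => nth (z i : A) s 0)) := e.
  have /(congr1 (fun s => nth (z i : A) s p)) := e.
  by rewrite !nth_win // !nth_mkseq // px addn0 addr0 => <- <-.
have pzk z (i : int) k : Omega x z -> z (i + (k * p)%N%:Z)%R = z i.
  move=> Oz; elim: k => [|k IH]; first by rewrite mul0n addr0.
  by rewrite mulSnr PoszD addrA pz.
have det z1 z2 : Omega x z1 -> Omega x z2 -> win z1 0%R p = win z2 0%R p -> z1 = z2.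
  move=> O1 O2 e.
  have en (n : nat) : z1 (Posz n) = z2 (Posz n).
    rewrite (divn_eq n p) addnC PoszD !pzk //.
    have /(congr1 (fun s => nth (z1 0%R : A) s (n %% p))) := e.
    by rewrite !nth_win ?ltn_mod // add0r.
  apply/funext => i; rewrite -(pzk z1 i `|i|%N O1) -(pzk z2 i `|i|%N O2).
  have -> : (i + (`|i| * p)%N%:Z = `|(i + (`|i| * p)%N%:Z)%R|%N%:Z)%R.
    have : `|i|%N <= `|i|%N * p by apply: leq_pmulr.
    by lia.
  exact: en.
(* By [det] a point is determined by its window of length [p] at 0, so this set of windows
   determines the cylinder itself, and equal types give equal cylinders. *)
pose ty (q : seq A * seq A) : {set p.-tuple A} :=
  [set t : p.-tuple A | `[< exists2 z, cylinder x q.1 q.2 z & win z 0%R p = t >]]%SET.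
have [reps [r1 r2]] := finite_representatives
  (fun q : seq A * seq A => cylinder x q.1 q.2 !=set0) ty.
exists reps; split=> // u v cuv.
have [q [qr Pq eq]] := r2 (u, v) cuv; exists q => //.
have sub q1 q2 : ty q1 = ty q2 -> cylinder x q1.1 q1.2 `<=` cylinder x q2.1 q2.2.
  move=> /setP e z cz; have st : size (win z 0%R p) == p by rewrite size_win.
  have := e (Tuple st); rewrite !inE; case: asboolP => [_|[]]; last by exists z.
  case: asboolP => // -[z' cz' ez'] _.
  by rewrite (det z z') //; [exact: cz.1|exact: cz'.1].
have -> : cylinder x u v = cylinder x q.1 q.2.
  by apply/seteqP; split; [apply: (sub (u, v))|apply: (sub q (u, v))].
by exists id, id; split=> //; apply: continuous_subspaceT => ? ?; exact: cvg_id.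
Qed.

(** * Iterated substitutions *)

Section Iteration.
Variable B : finType.
Implicit Types (s : B -> seq B) (u v : seq B).

Lemma iter_sub_cat s k u v :
  iter k (sub s) (u ++ v) = iter k (sub s) u ++ iter k (sub s) v.
Proof. by elim: k => //= k ->; rewrite sub_cat. Qed.

Lemma iter_sub_nil s k : iter k (sub s) [::] = [::].
Proof. by elim: k => //= k ->. Qed.

Lemma iter_subE s k u :
  iter k (sub s) u = sub (fun b => iter k (sub s) [:: b]) u.
Proof.
elim: u => [|b u IH]; first by rewrite iter_sub_nil.
by rewrite -cat1s iter_sub_cat IH sub_cons.
Qed.

Lemma sub_comp (C : finType) (f : B -> seq C) s u :
  sub f (sub s u) = sub (fun b => sub f (s b)) u.
Proof. by elim: u => //= b u IH; rewrite !sub_cons sub_cat IH. Qed.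

Lemma iter_sub_infix s k u v : infix u v ->
  infix (iter k (sub s) u) (iter k (sub s) v).
Proof. by rewrite !(iter_subE _ k); apply: infix_sub. Qed.

Lemma iter_sub_size_mono s u j k : (forall b, s b != [::]) -> j <= k ->
  size (iter j (sub s) u) <= size (iter k (sub s) u).
Proof.
move=> s0 /subnK <-; elim: (k - j) => // m IH; rewrite addSn iterS.
exact: leq_trans IH (size_sub_ge _ s0).
Qed.

Lemma mem_sub (C : finType) (f : B -> seq C) u c :
  (c \in sub f u) = has (fun b => c \in f b) u.
Proof. by elim: u => //= b u IH; rewrite sub_cons mem_cat IH. Qed.

Lemma sub_neq0 (C : finType) (f : B -> seq C) u :
  (forall b, f b != [::]) -> u != [::] -> sub f u != [::].
Proof. by case: u => // b u f0 _; rewrite sub_cons; case: (f b) (f0 b). Qed.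

Lemma has_split_last (p : pred B) u : has p u ->
  exists v l t, [/\ u = v ++ l :: t, p l & all (predC p) t].
Proof.
elim/last_ind: u => // u b IH; rewrite has_rcons.
have [pb _|npb] /= := boolP (p b).
  by exists u, b, [::]; rewrite cats1.
case/IH=> v [l [t [-> pl pt]]]; exists v, l, (rcons t b).
by rewrite all_rcons /= npb -cats1 -catA /= cats1.
Qed.

Lemma has_split_first (p : pred B) u : has p u ->
  exists t l v, [/\ u = t ++ l :: v, p l & all (predC p) t].
Proof.
elim: u => //= b u IH; have [pb _|npb /= /IH[t [l [v [-> pl pt]]]]] := boolP (p b).
  by exists [::], b, u.
by exists (b :: t), l, v; rewrite /= npb.
Qed.

Lemma suffix_free (p : pred B) w X l Y : suffix w (X ++ l :: Y) -> p l ->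
  all (predC p) w -> size w <= size Y.
Proof.
case/suffix_ex=> T e pl aw; rewrite leqNgt; apply/negP => lt.
suff : l \in w by move/(allP aw); rewrite /= pl.
have sz := congr1 size e; rewrite !size_cat /= in sz.
have := congr1 (drop (size T)) e; rewrite drop_size_cat // => <-.
rewrite drop_cat; case: ltnP => h; first by rewrite mem_cat mem_head orbT.
by rewrite (_ : size T - size X = 0) ?mem_head //; slia.
Qed.

Lemma prefix_free (p : pred B) w X l Y : prefix w (X ++ l :: Y) -> p l ->
  all (predC p) w -> size w <= size X.
Proof.
case/prefix_ex=> T e pl aw; rewrite leqNgt; apply/negP => lt.
suff : l \in w by move/(allP aw); rewrite /= pl.
have := congr1 (take (size w)) e; rewrite take_size_cat // => <-.
rewrite take_cat ifF; last by slia.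
have [m em] : exists m, size w - size X = m.+1 by exists (size w - size X).-1; slia.
by rewrite em mem_cat mem_head orbT.
Qed.

Lemma sub_nseq (C : finType) (f : B -> seq C) n u :
  sub f (flatten (nseq n u)) = flatten (nseq n (sub f u)).
Proof. by elim: n => //= n IH; rewrite sub_cat IH. Qed.

Lemma flatten_nseqSr n u : flatten (nseq n.+1 u) = flatten (nseq n u) ++ u.
Proof. by elim: n => [|n IH]; [rewrite /= cats0|rewrite /= -catA -IH]. Qed.

End Iteration.

(* [gr] selects the growing letters. The hypotheses [th_*_idem] hold for a
   suitable power of any non-erasing substitution. *)
Section IdempotentSubstitution.
Variables (A : finType) (x : nat -> A) (B : finType).
Variables (th : B -> seq B) (f : B -> seq A) (gr : pred B).
Hypothesis x_ur : uniformly_recurrent x.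
Hypothesis aper : ~ periodic x.
Hypothesis th0 : forall b, th b != [::].
Hypothesis f0 : forall b, f b != [::].
Hypothesis gr_th : forall b, gr b -> has gr (th b).
Hypothesis bd_th : forall b, ~~ gr b -> all (predC gr) (th b).
Hypothesis gr_unbounded : forall b, gr b ->
  forall N, exists k, N <= size (iter k (sub th) [:: b]).
Hypothesis th_mem_idem : forall b c, (c \in sub th (th b)) = (c \in th b).
Hypothesis th_last_idem : forall b v l t v' l' t',
  th b = v ++ l :: t -> gr l -> all (predC gr) t ->
  sub th (th b) = v' ++ l' :: t' -> gr l' -> all (predC gr) t' -> l = l'.
Hypothesis th_first_idem : forall b v l t v' l' t',
  th b = t ++ l :: v -> gr l -> all (predC gr) t ->
  sub th (th b) = t' ++ l' :: v' -> gr l' -> all (predC gr) t' -> l = l'.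
Hypothesis th_bd_idem : forall b, ~~ gr b -> sub th (th b) = th b.

Implicit Types (b c l : B) (u v w t X Y Z : seq B) (k : nat).

Let Th k u := iter k (sub th) u.
Let bd u := all (predC gr) u.
(** Substitute for a language over the alphabet of [th]: closed under factors and under [th]. *)
Let Lg u := forall k, language x (sub f (Th k u)).
Let M := \max_b size (th b).

Lemma size_th b : size (th b) <= M.
Proof. exact: (@leq_bigmax _ (fun b => size (th b)) b). Qed.

Lemma M_gt0 b : 0 < M.
Proof. by apply: leq_trans (size_th b); rewrite lt0n size_eq0. Qed.

Lemma Lg_infix u v : infix u v -> Lg v -> Lg u.
Proof.
move=> uv Lv k; apply: language_infix (Lv k).
by apply: infix_sub; apply: iter_sub_infix.
Qed.

Lemma Lg_th u : Lg u -> Lg (sub th u).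
Proof. by move=> Lu k; rewrite /Th -iterSr; exact: (Lu k.+1). Qed.

Lemma Lg_mem b c : Lg [:: b] -> c \in th b -> Lg [:: c].
Proof.
by rewrite -infix1s -(sub1 th b) => /Lg_th Lb cb; apply: Lg_infix cb Lb.
Qed.

Lemma bd_sub_th u : bd u -> bd (sub th u).
Proof.
elim: u => //= b u IH /andP[nb bu]; rewrite sub_cons /bd all_cat bd_th //.
exact: IH.
Qed.

Lemma bd_sub_idem u : bd u -> sub th (sub th u) = sub th u.
Proof.
by elim: u => //= b u IH /andP[nb bu]; rewrite !sub_cons sub_cat th_bd_idem // IH.
Qed.

Lemma Th_bd k u : bd u -> Th k.+1 u = sub th u.
Proof. by move=> bu; elim: k => //= k ->; rewrite bd_sub_idem. Qed.

Lemma size_Th_bd k u : bd u -> size (Th k u) <= size u * M.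
Proof.
have h : size (sub th u) <= size u * M.
  by apply: size_sub_le => b _; apply: size_th.
case: k => [|k] bu; last by rewrite Th_bd.
exact: leq_trans (size_sub_ge _ th0) h.
Qed.

Lemma gr_Th k b : gr b -> has gr (Th k [:: b]).
Proof.
move=> gb; elim: k => [|k /hasP[c cin gc]] /=; first by rewrite gb.
have /hasP[d dc gd] := gr_th gc; apply/hasP; exists d => //.
by rewrite mem_sub; apply/hasP; exists c.
Qed.

Lemma no_powers t : t != [::] -> ~ (forall n, Lg (flatten (nseq n t))).
Proof.
move=> t0 H; apply: aper; apply: (power_periodic x_ur (t := sub f t)).
  exact: sub_neq0.
by move=> n; have := H n 0; rewrite /Th /= sub_nseq.
Qed.

(** Otherwise [Th k.+1 [:: l]] ends in [l], then [t], then [k] copies of [sub th t], since bounded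
    words are stable after one step; this contradicts [no_powers]. *)
Lemma last_fixed l v t : Lg [:: l] -> th l = v ++ l :: t -> bd t -> t = [::].
Proof.
move=> Ll e bt; apply/eqP; apply/negPn/negP => t0.
apply: (@no_powers (sub th t)); first exact: sub_neq0.
have H k : exists V, Th k.+1 [:: l] = V ++ l :: t ++ flatten (nseq k (sub th t)).
  elim: k => [|k [V IH]]; first by exists v; rewrite /Th /= sub1 cats0.
  exists (sub th V ++ v); rewrite /Th iterS -/(Th _ _) IH !(sub_cat, sub_cons) e.
  by rewrite sub_nseq bd_sub_idem // -!catA.
move=> k; have [V eV] := H k.
have : Lg (Th k.+1 [:: l]) by move=> j; rewrite /Th -iterD; exact: (Ll (j + k.+1)).
apply: Lg_infix; rewrite eV; apply: suffixW.
by rewrite -cat_cons catA suffix_suffix.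
Qed.

Lemma first_fixed l v t : Lg [:: l] -> th l = t ++ l :: v -> bd t -> t = [::].
Proof.
move=> Ll e bt; apply/eqP; apply/negPn/negP => t0.
apply: (@no_powers (sub th t)); first exact: sub_neq0.
have H k : exists V, Th k.+1 [:: l] = flatten (nseq k (sub th t)) ++ t ++ l :: V.
  elim: k => [|k [V IH]]; first by exists v; rewrite /Th /= sub1.
  exists (v ++ sub th V); rewrite /Th iterS -/(Th _ _) IH !(sub_cat, sub_cons) e.
  by rewrite sub_nseq bd_sub_idem // flatten_nseqSr -!catA.
move=> k; have [V eV] := H k.
have : Lg (Th k.+1 [:: l]) by move=> j; rewrite /Th -iterD; exact: (Ll (j + k.+1)).
by apply: Lg_infix; rewrite eV; apply: prefix_infix.
Qed.

Lemma size_tail_th b v l t : th b = v ++ l :: t -> size t <= M.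
Proof. by move=> e; have := size_th b; rewrite e size_cat /=; slia. Qed.

Lemma size_head_th b v l t : th b = t ++ l :: v -> size t <= M.
Proof. by move=> e; have := size_th b; rewrite e size_cat /=; slia. Qed.

Lemma bd_infix1 b w : gr b -> bd w -> infix w [:: b] -> w = [::].
Proof. by move=> gb bw; rewrite infixs1 => /orP[/eqP ->|/eqP e] //; move: bw; rewrite e /bd /= gb. Qed.

(** From the first step on, the last growing letter is a fixed [l], and by [last_fixed] the images
    of [l] end in [l]. A bounded suffix thus lies in the image of the tail [t]: at most [M] letters,
    each with images of length at most [M]. *)
Lemma bd_suffix_bound k b w : gr b -> Lg [:: b] -> bd w ->
  suffix w (Th k [:: b]) -> size w <= M * M.
Proof.
move=> gb Lb bw; case: k => [|k].
  by move/suffixW/(bd_infix1 gb bw) ->.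
have [v [l [t [eb gl bt]]]] := has_split_last (gr_th gb).
have [v' [l' [t' [el gl' bt']]]] := has_split_last (gr_th gl).
have ell : l = l'.
  apply: (th_last_idem (b := b) (t' := t' ++ sub th t) eb gl bt
    (v' := sub th v ++ v')) => //.
    by rewrite eb sub_cat sub_cons el -!catA.
  by rewrite all_cat bt' /=; apply: bd_sub_th.
rewrite -ell in el.
have Ll : Lg [:: l] by apply: Lg_mem Lb _; rewrite eb mem_cat mem_head orbT.
have t'0 := last_fixed Ll el bt'; rewrite t'0 in el.
have [V eV] : exists V, Th k [:: l] = V ++ [:: l].
  elim: k => [|k [V IH]]; first by exists [::].
  by exists (sub th V ++ v'); rewrite /Th iterS -/(Th _ _) IH sub_cat sub1 el catA.
have -> : Th k.+1 [:: b] = (Th k v ++ V) ++ l :: Th k t.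
  rewrite /Th iterSr sub1 eb -cat1s !iter_sub_cat -!/(Th _ _) eV.
  by rewrite -!catA.
move=> sw; apply: leq_trans (suffix_free sw gl bw) _.
apply: leq_trans (size_Th_bd k bt) _; rewrite leq_mul2r (size_tail_th eb).
by rewrite orbT.
Qed.

Lemma bd_prefix_bound k b w : gr b -> Lg [:: b] -> bd w ->
  prefix w (Th k [:: b]) -> size w <= M * M.
Proof.
move=> gb Lb bw; case: k => [|k].
  by move/prefixW/(bd_infix1 gb bw) ->.
have [t [l [v [eb gl bt]]]] := has_split_first (gr_th gb).
have [t' [l' [v' [el gl' bt']]]] := has_split_first (gr_th gl).
have ell : l = l'.
  apply: (th_first_idem (b := b) (t' := sub th t ++ t') eb gl bt
    (v' := v' ++ sub th v)) => //.
    by rewrite eb sub_cat sub_cons el -!catA.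
  by rewrite all_cat bt' andbT; apply: bd_sub_th.
rewrite -ell in el.
have Ll : Lg [:: l] by apply: Lg_mem Lb _; rewrite eb mem_cat mem_head orbT.
have t'0 := first_fixed Ll el bt'; rewrite t'0 in el.
have [V eV] : exists V, Th k [:: l] = l :: V.
  elim: k => [|k [V IH]]; first by exists [::].
  by exists (v' ++ sub th V); rewrite /Th iterS -/(Th _ _) IH sub_cons el.
have -> : Th k.+1 [:: b] = Th k t ++ l :: (V ++ Th k v).
  by rewrite /Th iterSr sub1 eb -cat1s !iter_sub_cat -!/(Th _ _) eV.
move=> sw; apply: leq_trans (prefix_free sw gl bw) _.
apply: leq_trans (size_Th_bd k bt) _; rewrite leq_mul2r (size_head_th eb).
by rewrite orbT.
Qed.

Lemma bd_letter_bound k c w : ~~ gr c -> size w <= size (Th k [:: c]) ->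
  size w <= M * M.
Proof.
move=> nc le; apply: leq_trans le _.
have /(size_Th_bd k) : bd [:: c] by rewrite /bd /= nc.
rewrite mul1n => h; apply: leq_trans h _.
by rewrite leq_pmulr // (M_gt0 c).
Qed.

(** A run that meets several blocks consists of the end of one, whole blocks over bounded letters
    and the start of another; each part has length at most [M * M], hence the factor 3. A run inside
    one block is left to induction on [k]. *)
Lemma bd_run_bound k b w : gr b -> Lg [:: b] -> bd w ->
  infix w (Th k [:: b]) -> size w <= 3 * (M * M).
Proof.
elim: k b w => [|k IH] b w gb Lb bw; first by move/(bd_infix1 gb bw) ->.
rewrite /Th iterSr sub1 iter_subE => /sub_cover[u' [iu iw cases]].
have Lu c : c \in u' -> Lg [:: c].
  by move=> cu; apply: Lg_mem Lb _; apply: (mem_infix iu).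
case: cases => [su|[c [v [c' [X [Z [eu ew sX pZ]]]]]]].
  case: u' su iu iw Lu => [|c [|//]] _ _; first by rewrite infixs0 => /eqP ->.
  rewrite sub1 => iw /(_ c (mem_head _ _)) Lc.
  have [gc|nc] := boolP (gr c); first exact: (IH c).
  apply: leq_trans (bd_letter_bound nc (size_infix iw)) _.
  by rewrite leq_pmull.
move: bw; rewrite ew /bd !all_cat => /and3P[bX bv bZ].
have sizeX : size X <= M * M.
  have [gc|nc] := boolP (gr c); last exact: bd_letter_bound nc (size_suffix sX).
  by apply: bd_suffix_bound gc _ bX sX; apply: Lu; rewrite eu mem_head.
have sizeZ : size Z <= M * M.
  have [gc|nc] := boolP (gr c'); last exact: bd_letter_bound nc (size_prefix pZ).
  by apply: bd_prefix_bound gc _ bZ pZ; apply: Lu; rewrite eu inE mem_rcons mem_head orbT.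
have bdv : bd v.
  apply/allP => d dv /=; apply/negP => /(gr_Th k)/hasP[e ed ge].
  have := mem_infix_sub (fun b => iter k (sub th) [:: b]) dv.
  by move/mem_infix/(_ e ed)/(allP bv); rewrite /= ge.
have sizev : size (sub (fun b => iter k (sub th) [:: b]) v) <= M * M.
  rewrite -iter_subE; apply: leq_trans (size_Th_bd k bdv) _.
  rewrite leq_mul2r; apply/orP; right; apply: leq_trans (size_th b).
  have := size_infix iu; rewrite eu /= size_rcons; slia.
by rewrite !size_cat; slia.
Qed.

Lemma minimal_letter a : gr a -> Lg [:: a] -> exists a0,
  [/\ gr a0, Lg [:: a0], a0 \in th a0 &
    forall b, b \in th a0 -> gr b -> forall c, c \in th a0 -> c \in th b].
Proof.
move=> ga La; pose ok b := gr b && `[< Lg [:: b] >].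
pose al b := [set c in th b]%SET.
have oka : ok a by rewrite /ok ga; apply/asboolP.
have okstep b c : ok b -> c \in th b -> gr c -> ok c.
  move=> /andP[gb /asboolP Lb] cb gc; rewrite /ok gc; apply/asboolP.
  exact: Lg_mem cb.
have alsub b c : c \in th b -> al c \subset al b.
  move=> cb; apply/fintype.subsetP => d; rewrite !inE => dc; rewrite -th_mem_idem mem_sub.
  by apply/hasP; exists c.
case: (@arg_minnP _ a ok (fun b => #|al b|) oka) => g okg gmin.
(* The minimizer [g] need not occur in its own image. A growing letter [a0] of [th g] does, because
   by minimality [th a0] and [th g] have the same letters. *)
have [gg _] := andP okg; have /hasP[a0 a0g ga0] := gr_th gg.
have ok0 : ok a0 by apply: okstep okg a0g ga0.
have eq0 : al a0 = al g.
  by apply/eqP; rewrite eqEcard alsub // gmin.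
have a00 : a0 \in th a0.
  by have : a0 \in al g; [rewrite inE|rewrite -eq0 inE].
have [_ /asboolP L0] := andP ok0.
exists a0; split=> // b b0 gb c c0.
have okb : ok b by apply: okstep ok0 b0 gb.
have e : al b = al a0.
  by apply/eqP; rewrite eqEcard alsub // eq0 gmin.
by have : c \in al a0; [rewrite inE|rewrite -e inE].
Qed.

Lemma idempotent_frame a : gr a -> Lg [:: a] ->
  exists (F : set (seq B)) C q1, frame x F C q1.
Proof.
move=> ga La; have [a0 [g0 L0 a00 prim]] := minimal_letter ga La.
have memR k c : c \in Th k [:: a0] -> c \in th a0.
  elim: k c => [|k IH] c; first by rewrite inE => /eqP ->.
  rewrite /Th iterS mem_sub => /hasP[d /IH d0 cd]; rewrite -th_mem_idem mem_sub.
  by apply/hasP; exists d.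
pose F : set (seq B) := [set u | exists k, infix u (Th k [:: a0])].
have F_closed (u v : seq B) : infix u v -> F v -> F u.
  by move=> uv [k vk]; exists k; apply: infix_trans vk.
pose R0 := 3 * (M * M).
have F_gr u : F u -> R0 < size u -> exists d, [/\ d \in u, gr d & d \in th a0].
  move=> [k uk] su; have [/hasP[d du gd]|] := boolP (has gr u).
    by exists d; split=> //; apply: (memR k); apply: (mem_infix uk).
  rewrite -all_predC => bu; have := bd_run_bound g0 L0 bu uk.
  by rewrite leqNgt su.
have Th_gr k d : d \in th a0 -> gr d -> infix (Th k [:: a0]) (Th k.+1 [:: d]).
  move=> d0 gd; rewrite /Th iterSr sub1; apply: iter_sub_infix.
  by rewrite infix1s; apply: prim.
have le_size k b : b \in th a0 ->
    size (sub f (Th k [:: b])) <= size (sub f (Th k.+1 [:: a0])).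
  move=> b0; apply: size_infix; apply: infix_sub; rewrite /Th iterSr sub1.
  by apply: iter_sub_infix; rewrite infix1s.
(* For [k] least with [n <= size (sub f (Th k [:: a0]))], blocks come from [k + 1] steps and embed
   in the image of [a0] after [k + 2]. If [k >= 2], these are [k - 2] steps applied to the letters
   of [Th 4 [:: a0]], and by minimality each contributes less than [n]. The other summands serve
   [k = 0] and [k = 1]. *)
pose C := size (Th 4 [:: a0])
  + (size (sub f (Th 2 [:: a0])) + size (sub f (Th 3 [:: a0]))).
exists F, C, R0.+1; split=> //.
- move=> N; have [k Hk] := gr_unbounded g0 N.
  by exists (Th k [:: a0]) => //; exists k; apply: infix_refl.
(* A word longer than [R0 + 3] blocks [Th k.+1 [:: b]] contains more than [R0] whole ones, one of
   them over a growing letter; that block contains [Th k [:: a0]] and hence [u]. The last summand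
   excludes the iterates [j <= k.+1], which are too short. *)
- move=> u [k uk]; pose m := \max_b size (Th k.+1 [:: b]).
  exists ((R0 + 3) * m + size (Th k.+1 [:: a0])).+1 => v [j vj] sv.
  have sm b : size (Th k.+1 [:: b]) <= m.
    exact: (@leq_bigmax _ (fun b => size (Th k.+1 [:: b])) b).
  have [le|lt] := leqP j k.+1.
    have := leq_trans (size_infix vj) (iter_sub_size_mono _ th0 le).
    by move/(leq_trans sv); rewrite leqNgt ltnS leq_addl.
  have := vj; rewrite /Th -(subnKC (ltnW lt)) iterD iter_subE.
  case/sub_cover=> u' [iu iv cases].
  have su' : R0 + 3 < size u'.
    have := leq_trans (size_infix iv) (size_sub_le (fun b _ => sm b)).
    rewrite ltnNge => h; apply/negP => le; move: sv; rewrite ltnNge => /negP; apply.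
    apply: leq_trans h _; apply: leq_trans (leq_addr _ _).
    by rewrite leq_mul2r le orbT.
  case: cases => [|[b [t [b' [X [Z [eu ev _ _]]]]]]]; first by slia.
  have Ft : F t.
    exists (j - k.+1); apply: infix_trans iu.
    by rewrite eu -cats1 -cat1s infix_infix.
  have [|d [dt gd d0]] := F_gr _ Ft.
    by move: su'; rewrite eu /= size_rcons; slia.
  apply: infix_trans uk _; apply: infix_trans (Th_gr k d d0 gd) _.
  rewrite ev; apply: infix_catl; apply: infix_catr.
  exact: (mem_infix_sub (fun b => iter k.+1 (sub th) [:: b]) dt).
move=> n n0.
have exk : exists k, n <= size (sub f (Th k [:: a0])).
  have [k Hk] := gr_unbounded g0 n; exists k.
  exact: leq_trans Hk (size_sub_ge _ f0).
case: (ex_minnP exk) => k nk kmin.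
(* One step more than [k]: a growing letter of [th a0] produces [a0] in one step, so its block
   contains the image of [Th k [:: a0]], of length at least [n]. *)
exists (fun b => sub f (Th k.+1 [:: b])).
have subE u : sub (fun b => sub f (Th k.+1 [:: b])) u = sub f (Th k.+1 u).
  by rewrite /Th [iter k.+1 (sub th) u]iter_subE sub_comp.
split.
- move=> b; apply: sub_neq0 => //; rewrite -size_eq0 -lt0n.
  exact: leq_trans (iter_sub_size_mono [:: b] th0 (leq0n k.+1)).
- move=> u [j uj]; rewrite subE; apply: language_infix (L0 (k.+1 + j)).
  by rewrite /Th iterD; apply: infix_sub; apply: iter_sub_infix.
- move=> b [j]; rewrite infix1s => /memR b0.
  apply: leq_trans (le_size k.+1 b b0) _.
  case: k nk kmin subE => [|[|k]] nk kmin _.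
  + apply: leq_trans (leq_pmulr _ n0); rewrite /C; slia.
  + apply: leq_trans (leq_pmulr _ n0); rewrite /C; slia.
  apply: leq_trans (_ : size (Th 4 [:: a0]) * n <= _); last first.
    by rewrite leq_mul2r leq_addr orbT.
  have -> : Th k.+4 [:: a0] = Th k (Th 4 [:: a0]) by rewrite /Th -iterD addnC.
  rewrite /Th [iter k _ _]iter_subE sub_comp; apply: size_sub_le => e /(memR 4) e0.
  apply: leq_trans (le_size k e e0) _; rewrite leqNgt; apply/negP => lt.
  by have := kmin k.+1 (ltnW lt); rewrite ltnn.
move=> v Fv sv; have [d [dv gd d0]] := F_gr v Fv sv; apply: leq_trans nk _.
apply: size_infix; rewrite subE; apply: infix_sub.
apply: infix_trans (Th_gr k d d0 gd) _; apply: iter_sub_infix.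
by rewrite infix1s.
Qed.

End IdempotentSubstitution.

(** * Idempotent powers of a non-erasing substitution *)

Lemma eventually_idempotent (T : finType) (D : nat -> T) :
  (forall i j, D i = D j -> D i.+1 = D j.+1) -> exists2 P, 0 < P & D (P + P) = D P.
Proof.
move=> H.
have /injectivePn[i [j ij e]] : ~~ injectiveb (fun i : 'I_#|T|.+1 => D i).
  by apply/negP => /injectiveP /leq_card; rewrite card_ord ltnn.
wlog lt : i j ij e / i < j.
  move=> W; have [|] := ltnP i j; first exact: W.
  rewrite leq_eqVlt => /orP[/eqP/val_inj ji|]; last by apply: W; rewrite // eq_sym.
  by rewrite ji eqxx in ij.
pose p := j - i; have p0 : 0 < p by rewrite subn_gt0.
have step m : D (i + m + p) = D (i + m).
  elim: m => [|m IH]; first by rewrite addn0 /p subnKC // ltnW.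
  by rewrite addnS addSn; apply: H.
have steps m k : D (i + m + k * p) = D (i + m).
  elim: k => [|k IH]; first by rewrite mul0n addn0.
  by rewrite mulSnr addnA -(addnA i) step addnA.
have le : i <= i.+1 * p by apply: leq_trans (leqnSn i) _; rewrite leq_pmulr.
(* A multiple of the period [p] beyond the preperiod [i]; the successor keeps it positive when
   [i = 0]. *)
exists (i.+1 * p); first by rewrite muln_gt0.
by have := steps (i.+1 * p - i) i.+1; rewrite subnKC.
Qed.

Lemma iter_sub_pow (B : finType) (s : B -> seq B) P k u :
  iter k (sub (fun b => iter P (sub s) [:: b])) u = iter (k * P) (sub s) u.
Proof. by elim: k => //= k ->; rewrite -iter_subE mulSn iterD. Qed.

Section NonErasing.
Variables (A : finType) (x : nat -> A) (B : finType).
Variables (s : B -> seq B) (f : B -> seq A) (a : B).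
Hypothesis x_ur : uniformly_recurrent x.
Hypothesis aper : ~ periodic x.
Hypothesis s0 : forall b, s b != [::].
Hypothesis f0 : forall b, f b != [::].
Hypothesis La : forall k, language x (sub f (iter k (sub s) [:: a])).
Hypothesis a_unbounded : forall N, exists k, N <= size (iter k (sub s) [:: a]).

Let S k u := iter k (sub s) u.
Let gr : pred B := fun b => `[< forall N, exists k, N <= size (S k [:: b]) >].

Lemma bounded_letters : exists D, forall b, ~~ gr b -> forall k, size (S k [:: b]) <= D.
Proof.
have /choice[D HD] : forall b, exists D, ~~ gr b -> forall k, size (S k [:: b]) <= D.
  move=> b; have [|/asboolPn/existsNP[N HN]] := boolP (gr b); first by exists 0.
  exists N => _ k; rewrite leqNgt; apply/negP => lt; apply: HN; exists k.
  exact: ltnW.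
exists (\max_b D b) => b nb k; apply: leq_trans (HD b nb k) _.
exact: (@leq_bigmax _ D b).
Qed.

Lemma gr_step b : gr b -> has gr (s b).
Proof.
move=> /asboolP gb; apply/negPn/negP; rewrite -all_predC => bs.
have [D HD] := bounded_letters.
have [k] := gb (size (s b) * D).+2; case: k => [|k]; first by rewrite /S /=.
rewrite /S iterSr sub1 iter_subE => h.
have : size (sub (fun b => iter k (sub s) [:: b]) (s b)) <= size (s b) * D.
  by apply: size_sub_le => c cb; apply: HD; apply: (allP bs).
by slia.
Qed.

Lemma bd_step b : ~~ gr b -> all (predC gr) (s b).
Proof.
move=> nb; apply/allP => c cb /=; apply: contra nb => /asboolP gc.
apply/asboolP => N; have [k Hk] := gc N; exists k.+1; apply: leq_trans Hk _.
rewrite /S iterSr sub1; apply: size_infix; apply: iter_sub_infix.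
by rewrite infix1s.
Qed.

Let firstg u := ohead (seq.filter gr u).
Let lastg u := ohead (rev (seq.filter gr u)).

Lemma filter_bd u : all (predC gr) u -> seq.filter gr u = [::].
Proof. by move=> h; apply/eqP; rewrite -(negbK (_ == _)) -has_filter -all_predC. Qed.

Lemma firstg_split t l v : gr l -> all (predC gr) t -> firstg (t ++ l :: v) = Some l.
Proof. by move=> gl bt; rewrite /firstg filter_cat filter_bd //= gl. Qed.

Lemma lastg_split t l v : gr l -> all (predC gr) t -> lastg (v ++ l :: t) = Some l.
Proof.
by move=> gl bt; rewrite /lastg filter_cat /= gl (filter_bd bt) rev_cat.
Qed.

(** Bounded letters produce no growing letter and growing letters always produce one. *)
Lemma firstg_sub u : firstg (sub s u) = obind (fun c => firstg (s c)) (firstg u).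
Proof.
elim: u => //= b u IH; rewrite /firstg sub_cons filter_cat /=.
have [gb|nb] := boolP (gr b) => /=.
  by have := gr_step gb; rewrite has_filter; case: seq.filter.
by rewrite filter_bd ?bd_step.
Qed.

Lemma lastg_sub u : lastg (sub s u) = obind (fun c => lastg (s c)) (lastg u).
Proof.
elim/last_ind: u => //= u b IH; rewrite /lastg sub_rcons filter_cat filter_rcons.
have [gb|nb] := boolP (gr b).
  rewrite rev_rcons /= rev_cat; have := gr_step gb; rewrite has_filter.
  by case/lastP: (seq.filter gr (s b)) => // v c _; rewrite rev_rcons.
by rewrite (filter_bd (bd_step nb)) cats0.
Qed.

Lemma gr_iter k b : gr b -> has gr (S k [:: b]).
Proof.
move=> gb; elim: k => [|k /hasP[c cin gc]] /=; first by rewrite gb.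
have /hasP[d dc gd] := gr_step gc; apply/hasP; exists d => //.
by rewrite mem_sub; apply/hasP; exists c.
Qed.

Lemma bd_iter k b : ~~ gr b -> all (predC gr) (S k [:: b]).
Proof.
move=> nb; elim: k => [|k IH]; first by rewrite /= nb.
apply/allP => c; rewrite /S iterS mem_sub => /hasP[d dk cd].
by apply: (allP (bd_step _)) cd; apply: (allP IH).
Qed.

Lemma nonerasing_frame : exists (F : set (seq B)) C q1, frame x F C q1.
Proof.
have [D HD] := bounded_letters.
(* The entries at [k] determine those at [k.+1], as [eventually_idempotent] requires. Images of
   bounded letters have length at most [D] and are stored whole; growing letters get a constant
   there. *)
pose prof k := [ffun b : B => ([set c in S k [:: b]]%SET, firstg (S k [:: b]),
  lastg (S k [:: b]),
  if gr b then nil_bseq D B else insub_bseq D (S k [:: b]))].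
have [|P P0 eP] := @eventually_idempotent _ prof.
  move=> i j /ffunP e; apply/ffunP => b; move: (e b); rewrite !ffunE => -[e1 e2 e3 e4].
  rewrite /S !iterS -!/(S _ _) !firstg_sub !lastg_sub e2 e3; congr (_, _, _, _).
    apply/setP => c; rewrite !inE !mem_sub.
    apply/hasP/hasP => -[d dk cd]; exists d => //.
      by have /setP/(_ d) := e1; rewrite !inE => <-.
    by have /setP/(_ d) := e1; rewrite !inE => ->.
  have [gb|nb] := boolP (gr b) => //; rewrite (negbTE nb) in e4.
  have := congr1 (@bseqval _ _) e4; rewrite !insub_bseqK ?HD // => ->.
  by [].
pose th b := S P [:: b].
have thth b : sub th (th b) = S (P + P) [:: b] by rewrite /th /S -iter_subE iterD.
have eb b : [/\ [set c in S (P + P) [:: b]]%SET = [set c in S P [:: b]]%SET,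
    firstg (S (P + P) [:: b]) = firstg (S P [:: b]),
    lastg (S (P + P) [:: b]) = lastg (S P [:: b]) &
    ~~ gr b -> S (P + P) [:: b] = S P [:: b]].
  have /ffunP/(_ b) := eP; rewrite !ffunE => -[e1 e2 e3 e4]; split=> // nb.
  rewrite (negbTE nb) in e4.
  by have := congr1 (@bseqval _ _) e4; rewrite !insub_bseqK ?HD.
apply: (@idempotent_frame A x B th f gr x_ur aper _ f0 _ _ _ _ _ _ _ a).
- move=> b; rewrite -size_eq0 -lt0n.
  exact: leq_trans (iter_sub_size_mono [:: b] s0 (leq0n P)).
- by move=> b; apply: gr_iter.
- by move=> b; apply: bd_iter.
- move=> b /asboolP gb N; have [k Hk] := gb N; exists k; apply: leq_trans Hk _.
  by rewrite /th iter_sub_pow iter_sub_size_mono // leq_pmulr.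
- move=> b c; rewrite thth; have [/setP/(_ c) e _ _ _] := eb b.
  by rewrite !inE in e.
- move=> b v l t v' l' t' e gl bt e' gl' bt'; have [_ _ + _] := eb b.
  by rewrite -thth -/(th b) e' e !lastg_split // => -[].
- move=> b v l t v' l' t' e gl bt e' gl' bt'; have [_ + _ _] := eb b.
  by rewrite -thth -/(th b) e' e !firstg_split // => -[].
- by move=> b nb; rewrite thth; have [_ _ _ ->] := eb b.
- exact/asboolP.
- by move=> k; rewrite /th iter_sub_pow.
Qed.

End NonErasing.

(** * Reduction of morphic words to non-erasing substitutions *)

Lemma word_morphism_sub (A B : finType) (g : seq A -> seq B) :
  word_morphism g -> forall u, g u = sub (fun b => g [:: b]) u.
Proof.
move=> gm; elim=> [|b u IH]; last by rewrite -cat1s gm IH sub_cons.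
by apply/nilP; have := congr1 size (gm [::] [::]); rewrite size_cat /nilp /=; slia.
Qed.

Lemma cvg_infty_nat (g : nat -> nat) : g @ \oo --> \oo ->
  forall N, exists k0, forall k, k0 <= k -> N <= g k.
Proof.
move=> h N; have [k0 _ H] := h _ (nbhs_infty_ge N).
by exists k0 => k kk; apply: H.
Qed.

Lemma morphic_iterates (A : finType) (x : nat -> A) : morphic x ->
  exists (B : finType) (s : B -> seq B) (f : B -> seq A) (a : B),
    (forall k, language x (sub f (iter k (sub s) [:: a]))) /\
    (forall N, exists k0, forall k, k0 <= k -> N <= size (sub f (iter k (sub s) [:: a]))).
Proof.
case=> B [sg [a [y [phi [sm [_ sgrow] ylim pm [ximg xgrow]]]]]].
exists B, (fun b => sg [:: b]), (fun b => phi [:: b]), a.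
have E k : sub (fun b => phi [:: b]) (iter k (sub (fun b => sg [:: b])) [:: a]) =
    phi (mkseq y (size (iter k sg [:: a]))).
  rewrite -word_morphism_sub // ylim; congr phi.
  by apply: eq_iter => u; rewrite -word_morphism_sub.
split=> [k|N].
  by rewrite E -ximg; apply: (language_mkseq x 0).
have [n0 H0] := cvg_infty_nat xgrow N.
have [k0 H1] := cvg_infty_nat sgrow n0.
by exists k0 => k kk; rewrite E; apply: H0; apply: H1.
Qed.

Lemma morphic_nonerasing (A : finType) (x : nat -> A) : morphic x ->
  exists (B : finType) (s : B -> seq B) (f : B -> seq A) (a : B),
    [/\ forall b, s b != [::], forall b, f b != [::],
        forall k, language x (sub f (iter k (sub s) [:: a])) &
        forall N, exists k, N <= size (iter k (sub s) [:: a])].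
Proof.
move/morphic_iterates=> [B [s [f [a [La grow]]]]].
pose prof k := [ffun b : B => [set c in iter k (sub s) [:: b]]%SET].
have [|P P0 eP] := @eventually_idempotent _ prof.
  move=> i j /ffunP e; apply/ffunP => b; move: (e b); rewrite !ffunE => e1.
  apply/setP => c; rewrite !inE /= !mem_sub; apply/hasP/hasP => -[d dk cd]; exists d => //.
    by have /setP/(_ d) := e1; rewrite !inE => <-.
  by have /setP/(_ d) := e1; rewrite !inE => ->.
pose th b := iter P (sub s) [:: b].
have th_idem b c : (c \in sub th (th b)) = (c \in th b).
  rewrite /th -iter_subE -iterD; have /ffunP/(_ b) := eP.
  by rewrite !ffunE => /setP/(_ c); rewrite !inE.
(* Idempotence of the letter sets makes the set E of letters erased by g
   invariant under th in both directions, so E can be deleted from all words. *)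
pose g b := sub f (th b); pose E : pred B := fun b => g b == [::].
have gE b : E b = all (fun c => f c == [::]) (th b).
  by rewrite /E /g; elim: (th b) => //= c u <-; rewrite sub_cons; case: (f c).
have E_th b : E b -> all E (th b).
  rewrite gE => /allP Eb; apply/allP => c cb; rewrite gE; apply/allP => d dc.
  by apply: Eb; rewrite -th_idem mem_sub; apply/hasP; exists c.
have nE_th b : ~~ E b -> has (predC E) (th b).
  apply: contraR; rewrite -all_predC gE => /allP h; apply/allP => d.
  rewrite -th_idem mem_sub => /hasP[c cb dc].
  by have := h c cb; rewrite /= negbK gE => /allP; apply.
(* Letters of [E] get placeholder images that keep [s'] and [g'] non-erasing; [pi] removes these
   letters before the maps are applied. *)
pose s' b := if E b then [:: b] else seq.filter (predC E) (th b).
pose g' b := if E b then [:: x 0] else g b.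
pose pi := seq.filter (predC E).
have pi_th u : pi (sub th u) = sub s' (pi u).
  elim: u => //= b u IH; rewrite sub_cons /pi filter_cat -!/(pi _) IH.
  have [Eb|nEb] /= := boolP (E b).
    rewrite /pi (eq_in_filter (a2 := pred0)) ?filter_pred0 // => c cb.
    by rewrite /= (allP (E_th b Eb)).
  by rewrite sub_cons /s' (negbTE nEb).
have pi_g u : sub g u = sub g' (pi u).
  elim: u => //= b u IH; rewrite sub_cons IH.
  have [Eb|nEb] /= := boolP (E b); first by rewrite (eqP Eb).
  by rewrite sub_cons /g' (negbTE nEb).
have pi_iter k u : pi (iter k (sub th) u) = iter k (sub s') (pi u).
  by elim: k => //= k IH; rewrite pi_th IH.
have E1 k : sub g (iter k (sub th) [:: a]) = sub f (iter (P + k * P) (sub s) [:: a]).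
  by rewrite /th iter_sub_pow iterD [iter P _ _]iter_subE sub_comp.
have growP N : exists k, N <= size (sub g (iter k (sub th) [:: a])).
  have [k0 H] := grow N; exists k0; rewrite E1; apply: H.
  by apply: leq_trans (leq_addl _ _); apply: leq_pmulr.
have pia : pi [:: a] = [:: a].
  rewrite /pi /=; have [Ea|//] := boolP (E a); exfalso.
  have [k] := growP 1; rewrite pi_g pi_iter /pi /= Ea /= iter_sub_nil.
  by [].
have E2 k : sub g' (iter k (sub s') [:: a]) = sub f (iter (P + k * P) (sub s) [:: a]).
  by rewrite -E1 pi_g pi_iter pia.
exists B, s', g', a; split.
- move=> b; rewrite /s'; have [//|nEb] := boolP (E b).
  by rewrite -has_filter nE_th.
- by move=> b; rewrite /g'; have [//|nEb] := boolP (E b).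
- by move=> k; rewrite E2.
(* Each letter has an image of length at most [m] under [g'], so images longer than [N * m] come
   from at least [N] letters. *)
move=> N; pose m := \max_b size (g' b).
have [k Hk] := growP (N * m).+1; exists k.
have := Hk; rewrite pi_g pi_iter pia => h.
have h2 : size (sub g' (iter k (sub s') [:: a])) <= size (iter k (sub s') [:: a]) * m.
  by apply: size_sub_le => b _; apply: (@leq_bigmax _ (fun b => size (g' b)) b).
rewrite leqNgt; apply/negP => lt; have := leq_trans h h2.
by rewrite ltnNge leq_mul2r ltnW ?orbT.
Qed.

Theorem theorem40 (A : finType) (x : nat -> A)
    (x_morphic : morphic x) (x_ur : uniformly_recurrent x) :
  exists reps : seq (seq A * seq A),
    (forall p, p \in reps -> cylinder x p.1 p.2 !=set0) /\
    (forall u v : seq A, cylinder x u v !=set0 ->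
      exists2 p, p \in reps &
        conjugate (cylinder x u v) (induced (@shift A) (cylinder x u v))
          (cylinder x p.1 p.2) (induced (@shift A) (cylinder x p.1 p.2))).
Proof.
have [per|aper] := pselect (periodic x); first exact: periodic_finitely_many.
have [B [s [f [a [s0 f0 La una]]]]] := morphic_nonerasing x_morphic.
have [F [C [q1 FR]]] := nonerasing_frame x_ur aper s0 f0 La una.
exact: frame_finitely_many FR aper.
Qed.
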